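(* Let $d\ge2$, $0\le r_0<r_1\le\infty$, and let $f:A(r_0,r_1)\to\mathbb{C}$ be polyharmonic of infinite order and type $\tau\ge0$. Let $\widetilde f_{k,l}(v)=f_{k,l}(e^v)$ for $v\in(\log r_0,\log r_1)$. Then for every $v_0\in(\log r_0,\log r_1)$ and every $\varepsilon>0$ there is a constant $C>0$ such that $$\left|D^{(n)}\widetilde f_{k,l}(v_0)\right|\le C\,n!\,\left[e^{v_0}(\tau+\varepsilon)\right]^n$$ for all $n\in\mathbb{N}_0$, all $k\in\mathbb{N}_0$ and all $l=1,\dots,a_k$, where $D^{(n)}$ is taken with respect to the exponents $\lambda_j=\lambda_j(k,d)$.
   Context: $A(r_0,r_1)=\{x\in\mathbb{R}^d: r_0<|x|<r_1\}$ ($\log 0=-\infty$). A function $f:G\to\mathbb{C}$ on a domain $G\subset\mathbb{R}^d$ is polyharmonic of infinite order and type $\tau\ge0$ if $f\in C^\infty(G)$ and for every compact $K\subset G$ and every $\varepsilon>0$ there is $C_{K,\varepsilon}>0$ with $\max_{x\in K}|\Delta^p f(x)|\le C_{K,\varepsilon}(2p)!(\tau+\varepsilon)^{2p}$ for all $p\in\mathbb{N}_0$. $Y_{k,l}$, $l=1,\dots,a_k$, is an orthonormal basis (in $L^2(\mathbb{S}^{d-1},d\theta)$, $d\theta$ the rotation-invariant surface measure) of the harmonic homogeneous polynomials of degree $k$, and $f_{k,l}(r)=\int_{\mathbb{S}^{d-1}}f(r\theta)\overline{Y_{k,l}(\theta)}d\theta$. For $k\in\mathbb{N}_0$ the exponents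 are $\lambda_{2j}(k,d)=k+2j$, $\lambda_{2j+1}(k,d)=-k-d+2+2j$ ($j\in\mathbb{N}_0$), and $D^{(n)}g=(\frac{d}{dv}-\lambda_0)\cdots(\frac{d}{dv}-\lambda_{n-1})g$, $D^{(0)}g=g$. *)

(* Defs.v *)
From HB Require Import structures.
From mathcomp Require Import all_boot all_order all_algebra.
From mathcomp Require Import all_classical all_reals all_analysis.
From mathcomp Require Import complex.
Import Order.TTheory GRing.Theory Num.Theory.
Import numFieldNormedType.Exports.

Set Implicit Arguments.
Unset Strict Implicit.
Unset Printing Implicit Defensive.

Local Open Scope classical_set_scope.
Local Open Scope ring_scope.
Local Open Scope complex_scope.

Section PolyharmonicDefs.
Context {R : realType}.

Definition enorm {d : nat} (x : 'rV[R]_d) : R :=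
  Num.sqrt (\sum_(i < d) x 0 i ^+ 2).

Definition evec {d : nat} (i : 'I_d) : 'rV[R]_d := delta_mx 0 i.

Definition annulus (d : nat) (r0 : R) (r1 : \bar R) : set 'rV[R]_d :=
  [set x | r0 < enorm x /\ ((enorm x)%:E < r1)%E].

Definition ReF {T : Type} (F : T -> R[i]) : T -> R := fun x => complex.Re (F x).
Definition ImF {T : Type} (F : T -> R[i]) : T -> R := fun x => complex.Im (F x).

Definition iterD {d : nat} (ls : seq 'I_d) (g : 'rV[R]_d -> R) : 'rV[R]_d -> R :=
  foldr (fun i h => 'D_(evec i) h) g ls.

Definition smoothR {d : nat} (G : set 'rV[R]_d) (g : 'rV[R]_d -> R) : Prop :=
  (forall (ls : seq 'I_d) (x : 'rV[R]_d), G x -> {for x, continuous (iterD ls g)}) /\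
  (forall (ls : seq 'I_d) (i : 'I_d) (x : 'rV[R]_d), G x ->
      derivable (iterD ls g) x (evec i)).

Definition smoothC {d : nat} (G : set 'rV[R]_d) (F : 'rV[R]_d -> R[i]) : Prop :=
  smoothR G (ReF F) /\ smoothR G (ImF F).

Definition lapR {d : nat} (g : 'rV[R]_d -> R) : 'rV[R]_d -> R :=
  fun x => \sum_(i < d) 'D_(evec i) ('D_(evec i) g) x.

Definition lapC {d : nat} (F : 'rV[R]_d -> R[i]) : 'rV[R]_d -> R[i] :=
  fun x => (lapR (ReF F) x) +i* (lapR (ImF F) x).

Definition polyharmonic_inf {d : nat} (G : set 'rV[R]_d) (F : 'rV[R]_d -> R[i])
    (tau : R) : Prop :=
  smoothC G F /\
  forall K : set 'rV[R]_d, compact K -> K `<=` G ->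
  forall eps : R, 0 < eps ->
  exists C : R, 0 < C /\
    forall (p : nat) (x : 'rV[R]_d), K x ->
      `| iter p lapC F x | <= (C * (p.*2)`!%:R * (tau + eps) ^+ (p.*2))%:C.

(* iterated Lebesgue integral over the cube [-1,1]^n of F (which only looks
   at the coordinates 0..n-1) *)
Fixpoint cube_int (n : nat) (F : (nat -> R) -> R) : R :=
  match n with
  | 0 => F (fun _ => 0)
  | n'.+1 => Rintegral lebesgue_measure `[-1, 1]
              (fun t => cube_int n' (fun x => F (fun j => if j == n' then t else x j)))
  end.

(* integral over the unit sphere S^{d-1} with respect to the rotation-invariant
   surface measure, via  int_{S^{d-1}} g dtheta = d * int_{|x|<=1} g(x/|x|) dx *)
Definition sphere_intR (d : nat) (g : 'rV[R]_d -> R) : R :=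
  d%:R * cube_int d (fun x =>
    let y := \row_(i < d) x (nat_of_ord i) in
    if enorm y <= 1 then g ((enorm y)^-1 *: y) else 0).

Definition sphere_int (d : nat) (g : 'rV[R]_d -> R[i]) : R[i] :=
  (sphere_intR (ReF g)) +i* (sphere_intR (ImF g)).

Definition harm_hom_poly (d k : nat) (Y : 'rV[R]_d -> R[i]) : Prop :=
  (exists c : {ffun 'I_d -> 'I_k.+1} -> R[i],
     forall x : 'rV[R]_d,
       Y x = \sum_(al : {ffun 'I_d -> 'I_k.+1} | (\sum_(i < d) (al i : nat))%N == k)
               c al * \prod_(i < d) ((x 0 i)%:C ^+ al i)) /\
  (forall x, lapC Y x = 0).

Definition sph_harm_onb (d : nat) (a : nat -> nat) (Y : nat -> nat -> 'rV[R]_d -> R[i])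
    : Prop :=
  forall k : nat,
    (forall l, (1 <= l <= a k)%N -> harm_hom_poly k (Y k l)) /\
    (forall l l', (1 <= l <= a k)%N -> (1 <= l' <= a k)%N ->
       sphere_int (fun th => Y k l th * Num.conj (Y k l' th)) = (l == l')%:R) /\
    (forall P, harm_hom_poly k P ->
       exists c : nat -> R[i], forall x,
         P x = \sum_(1 <= l < (a k).+1) c l * Y k l x).

Definition fkl (d : nat) (f : 'rV[R]_d -> R[i]) (Y : nat -> nat -> 'rV[R]_d -> R[i])
    (k l : nat) (r : R) : R[i] :=
  sphere_int (fun th => f (r *: th) * Num.conj (Y k l th)).

Definition lam (k d : nat) (j : nat) : R :=
  if odd j then - k%:R - d%:R + 2 + 2 * (j./2)%:R
  else k%:R + 2 * (j./2)%:R.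

Definition derivC (g : R -> R[i]) : R -> R[i] :=
  fun v => (derive1 (ReF g) v) +i* (derive1 (ImF g) v).

Definition Dstep (c : R) (g : R -> R[i]) : R -> R[i] :=
  fun v => derivC g v - c%:C * g v.

Fixpoint Dop (lm : nat -> R) (n : nat) (g : R -> R[i]) : R -> R[i] :=
  match n with
  | 0 => g
  | n'.+1 => Dstep (lm 0%N) (Dop (fun j => lm j.+1) n' g)
  end.

End PolyharmonicDefs.

(* Main.v *)
(** Since (d/dv - k)(d/dv + k + d - 2) applied to g_kl(e^v) gives e^(2v) (Delta g)_kl(e^v)
(Green's formula on the sphere against the harmonic homogeneous polynomial Y_kl), one gets
D^(2p) f~_kl(v) = e^(2pv) (Delta^p f)_kl(e^v), and the bound for even n follows from the growth of
Delta^p f, uniformly in (k, l) because Y_kl is L^2-normalized.  For n = 2p+1 put h = D^(2p) f~_kl,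
u = h' - a h with a = k + 2p, and b = 2p - k - d + 2, so that H := u' - b u = D^(2p+2) f~_kl.  With
s0 = v0 - delta, the function e^(b (v0 - s)) ((s - s0) u(s) - h(s)) has a derivative in which u no
longer occurs, hence delta |u(v0)| is controlled by sup |h| and sup |H|.  The choice
delta = const / (p + 1) absorbs the factorials; k <= 4p + 4 and k > 4p + 4 are treated separately,
the latter using the decay of e^(b (v0 - s)).

The sphere integral is an iterated integral of a discontinuous function over a cube.  Dominated
convergence, applied coordinate by coordinate, makes it a limit of integrals of compactly supported
C^1 functions, for which integration by parts is the fundamental theorem of calculus. *)

Require Import Defs.
From HB Require Import structures.
From mathcomp Require Import all_boot all_order all_algebra.
From mathcomp Require Import all_classical all_reals all_analysis.
From mathcomp Require Import complex measurable_realfun ring lra.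
Import Order.TTheory GRing.Theory Num.Theory.
Import numFieldNormedType.Exports.
Set Implicit Arguments.
Unset Strict Implicit.
Unset Printing Implicit Defensive.
Local Open Scope classical_set_scope.
Local Open Scope ring_scope.

(** * Integration over the cube *)

Section CubeIntegral.
Context {R : realType}.
Local Notation mu := (@lebesgue_measure R).
Local Notation I := (`[-1, 1]%classic : set R).
Implicit Types (F G : (nat -> R) -> R) (x : nat -> R).

(** Odd orders are the obstacle: they contain one first-order factor beyond a power of the
    Laplacian, and its exponents grow with [k], so bounding derivatives directly would cost a factor
    unbounded in [k]. Estimating on an interval to the left of [v0] keeps [expR s <= expR v0], so
    the rate [expR v0 * (tau + eps)] is not enlarged. Its length is of order 1/(p + 1) because the
    admissible bounds for the orders 2p, 2p + 1, 2p + 2 differ successively by factors of order p: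
    dividing the bound for [h] by the length, and multiplying the bound for [H] by it, both give the
    bound wanted for [u]. Real and imaginary parts of f times the conjugate of Y both have the form
    f1 P1 + f2 P2 with P1, P2 real harmonic, so the analysis is done once, over the reals, for such
    pairs. An iterated integral requires measurability at every level. It is obtained from a class
    of functions stable under fixing a coordinate and under bounded pointwise limits. Integration by
    parts on the sphere comes from the cube, by extending tangential fields radially, without polar
    coordinates. *)

Lemma itv_measure_fin : (mu I < +oo)%E.
Proof.
rewrite lebesgue_measure_itv/= lte_fin.
have -> : (-1 < 1 :> R) by lra.
by rewrite -EFinB ltry.
Qed.

Lemma fine_itv_measure : fine (mu I) = 2.
Proof.
rewrite lebesgue_measure_itv/= lte_fin.
have -> : (-1 < 1 :> R) by lra.
by rewrite -EFinB /=; lra.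
Qed.

Lemma itv_integrable (f : R -> R) (M : R) : measurable_fun setT f ->
  (forall t, `|f t| <= M) -> mu.-integrable I (EFin \o f).
Proof.
move=> mf fM; apply: measurable_bounded_integrable => //.
- exact: itv_measure_fin.
- exact: measurable_funTS.
- exists M; split; first exact: num_real.
  by move=> K MK t _ /=; apply: le_trans (fM t) (ltW MK).
Qed.

Lemma itv_Rintegral_bound (f : R -> R) (M : R) : measurable_fun setT f ->
  (forall t, `|f t| <= M) -> `|Rintegral mu I f| <= 2 * M.
Proof.
move=> mf fM; have iF := itv_integrable mf fM.
apply: le_trans (le_normr_Rintegral _ iF) _ => //.
have M0 : 0 <= M by apply: le_trans (fM 0).
rewrite mulrC -fine_itv_measure -Rintegral_cst//.
apply: le_Rintegral => //.
- apply: (@itv_integrable _ M) => //; first exact: measurableT_comp.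
  by move=> t; rewrite normr_id.
- apply: (@itv_integrable _ M) => //.
  by move=> t; rewrite ger0_norm.
Qed.

Lemma itv_Rintegral_cvg (fs : nat -> R -> R) (f : R -> R) (M : R) :
  (forall m, measurable_fun setT (fs m)) -> (forall m t, `|fs m t| <= M) ->
  (forall t, fs m t @[m --> \oo] --> f t) ->
  Rintegral mu I (fs m) @[m --> \oo] --> Rintegral mu I f.
Proof.
move=> mfs fM fsf.
have mf : measurable_fun setT f.
  by apply: measurable_fun_cvg => // t _; exact: fsf.
have fM' t : `|f t| <= M.
  have h : `|fs m t| @[m --> \oo] --> `|f t| by apply: cvg_norm; exact: fsf.
  rewrite -(cvg_lim _ h)//; apply: limr_le; first by apply/cvg_ex; exists `|f t|.
  by apply: nearW => m; exact: fM.
have iF := itv_integrable mf fM'.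
rewrite /Rintegral; apply: fine_cvg; rewrite fineK; last exact: integrable_fin_num.
have := (@dominated_cvg _ _ _ mu I _ (fun m => EFin \o fs m) (EFin \o f) (EFin \o cst M)). apply => //.
- by move=> m; apply/measurable_EFinP; apply: measurable_funTS; exact: mfs.
- by move=> t _; apply: cvg_EFin; [exact: nearW | exact: fsf].
- apply: (@itv_integrable _ `|M|) => //.
- by move=> m t _; rewrite /= lee_fin.
Qed.

(** Measurability of [f] is a conclusion: off a measurable null singleton it agrees with [g]. *)
Lemma Rintegral_except1 (f g : R -> R) (a : R) : measurable_fun setT g ->
  (forall t, t != a -> f t = g t) ->
  measurable_fun setT f /\ Rintegral mu I f = Rintegral mu I g.
Proof.
move=> mg fg.
have mf1 (D : set R) : measurable D -> measurable_fun (D `\ a) f.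
  move=> mD; apply: (eq_measurable_fun g).
    by move=> t; rewrite inE => -[_ /= /eqP ta]; rewrite fg.
  exact: measurable_funTS.
split.
- have -> : [set: R] = (setT `\ a) `|` [set a].
    by rewrite setDE setTI setUC setUv.
  apply/measurable_funU => //; first exact: measurableD.
  split; first exact: mf1.
  apply: (eq_measurable_fun (cst (f a))) => //.
  by move=> t; rewrite inE => ->.
- rewrite /Rintegral; congr fine.
  rewrite -(@integral_setD1 _ _ a I).
  + rewrite -(@integral_setD1 _ (fun t => (g t)%:E) a I).
    * apply: eq_integral => t; rewrite inE => -[_ /= /eqP ta].
      by rewrite fg.
    * exact: measurableD.
    * by apply/measurable_EFinP; exact: measurable_funTS.
  + exact: measurableD.
  + by apply/measurable_EFinP; exact: mf1.
Qed.

Lemma Rintegral_except (f g : R -> R) (s : seq R) : measurable_fun setT g ->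
  (forall t, t \notin s -> f t = g t) ->
  measurable_fun setT f /\ Rintegral mu I f = Rintegral mu I g.
Proof.
move=> mg; elim: s f => [|a s IH] f fg.
  have -> : f = g by apply/funext => t; exact: fg.
  by [].
(* Repairing the value at [a] leaves exceptions in [s] only, so the induction hypothesis applies to
   [f']. *)
pose f' t := if t == a then g t else f t.
have [|mf' e'] := IH f'.
  by move=> t ts; rewrite /f'; case: eqP => // /eqP ta; apply: fg; rewrite inE negb_or ta.
rewrite -e'; apply: (@Rintegral_except1 _ _ a) => // t ta.
by rewrite /f' (negbTE ta).
Qed.

Lemma continuous_seq (f : R -> R) (p : R) :
  (forall u : nat -> R, u m @[m --> \oo] --> p -> f (u m) @[m --> \oo] --> f p) ->
  {for p, continuous f}.
Proof.
by move=> h; apply/continuous_withinNx/cvgr_dnbhsP => u [_ up]; exact: h.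
Qed.

(** Convertible to the substitution in the body of [cube_int], so unfolding one level of the
    integral produces sections of this form. *)
Definition upd x n t : nat -> R := fun j => if j == n then t else x j.

(** Sequential continuity for the product topology, the form in which dominated convergence can use
    it. *)
Definition scont F := forall (xs : nat -> nat -> R) x,
  (forall j, xs m j @[m --> \oo] --> x j) -> F (xs m) @[m --> \oo] --> F x.

(* Baire hierarchy over bounded continuous functions; it replaces measurability on the product space. *)
Inductive baire : ((nat -> R) -> R) -> Prop :=
| baire_cont F (M : R) : scont F -> (forall x, `|F x| <= M) -> baire F
| baire_lim (Fs : nat -> (nat -> R) -> R) F (M : R) : (forall m, baire (Fs m)) ->
    (forall m x, `|Fs m x| <= M) ->
    (forall x, Fs m x @[m --> \oo] --> F x) -> baire F.

Lemma cvg_norm_le (u : nat -> R) (l M : R) :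
  u m @[m --> \oo] --> l -> (forall m, `|u m| <= M) -> `|l| <= M.
Proof.
move=> ul uM.
have h : `|u m| @[m --> \oo] --> `|l| by apply: cvg_norm.
rewrite -(cvg_lim _ h)//; apply: limr_le; first by apply/cvg_ex; exists `|l|.
by apply: nearW => m; exact: uM.
Qed.

Lemma baire_bounded F : baire F -> exists M, forall x, `|F x| <= M.
Proof.
case=> {F} [F M _ h|Fs F M _ h hc]; exists M => // x.
exact: cvg_norm_le (hc x) _.
Qed.

Lemma upd_cvg (xs : nat -> nat -> R) x n (ts : nat -> R) t :
  (forall j, xs m j @[m --> \oo] --> x j) -> ts m @[m --> \oo] --> t ->
  forall j, upd (xs m) n (ts m) j @[m --> \oo] --> upd x n t j.
Proof. by move=> h ht j; rewrite /upd; case: (j == n). Qed.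

Lemma scont_upd F n t : scont F -> scont (fun x => F (upd x n t)).
Proof. by move=> cF xs x h; apply: cF; apply: upd_cvg => //; exact: cvg_cst. Qed.

Lemma baire_upd F n t : baire F -> baire (fun x => F (upd x n t)).
Proof.
elim=> {F} [F M cF bF|Fs F M _ IH bF cF].
  by apply: (@baire_cont _ M) => //; exact: scont_upd.
by apply: (@baire_lim (fun m x => Fs m (upd x n t)) _ M).
Qed.

(** The two clauses are carried through one induction on [n]: measurability of the next outer
    integrand rests on dominated convergence in the [n] inner variables, and its integrability on
    the bound. *)
Definition cube_regular n :=
  (forall Fs F (M : R), (forall m, baire (Fs m)) -> (forall m x, `|Fs m x| <= M) ->
     (forall x, Fs m x @[m --> \oo] --> F x) ->
     cube_int n (Fs m) @[m --> \oo] --> cube_int n F) /\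
  (forall F (M : R), baire F -> (forall x, `|F x| <= M) -> `|cube_int n F| <= 2 ^+ n * M).

(** For continuous [F] the section is continuous in [t] by dominated convergence in the inner
    variables; a bounded limit of such [F] gives a pointwise limit of measurable sections. *)
Lemma section_measurable n F : cube_regular n -> baire F ->
  measurable_fun setT (fun t => cube_int n (fun x => F (upd x n t))).
Proof.
move=> [Pc Pb]; elim=> {F} [F M cF bF|Fs F M bFs IH bF cF].
- apply: continuous_measurable_fun => t.
  apply: continuous_seq => u ut; apply: (Pc _ _ M) => //.
  + by move=> m; apply: baire_upd; exact: baire_cont bF.
  + by move=> x; apply: cF; apply: upd_cvg => // j; exact: cvg_cst.
- apply: (measurable_fun_cvg IH) => t _.
  by apply: (Pc _ _ M) => // m; exact: baire_upd.
Qed.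

Lemma cube_regularP n : cube_regular n.
Proof.
elim: n => [|n IH].
  split=> /= [Fs F M _ _ h|F M _ h]; first exact: h.
  by rewrite expr0 mul1r.
have [Pc Pb] := IH; split=> [Fs F M bFs FM cF|F M bF FM] /=.
- apply: (@itv_Rintegral_cvg _ _ (2 ^+ n * M)).
  + by move=> m; exact: (section_measurable IH).
  + by move=> m t; apply: Pb => //; exact: baire_upd.
  + by move=> t; apply: (Pc _ _ M) => // m; exact: baire_upd.
- rewrite exprS -mulrA; apply: itv_Rintegral_bound.
    exact: (section_measurable IH).
  by move=> t; apply: Pb => //; exact: baire_upd.
Qed.

Lemma cube_cvg n Fs F (M : R) : (forall m, baire (Fs m)) -> (forall m x, `|Fs m x| <= M) ->
     (forall x, Fs m x @[m --> \oo] --> F x) ->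
     cube_int n (Fs m) @[m --> \oo] --> cube_int n F.
Proof. exact: (cube_regularP n).1. Qed.

Lemma cube_bound n F (M : R) : baire F -> (forall x, `|F x| <= M) ->
  `|cube_int n F| <= 2 ^+ n * M.
Proof. exact: (cube_regularP n).2. Qed.

Lemma section_integrable n F : baire F ->
  mu.-integrable I (EFin \o (fun t => cube_int n (fun x => F (upd x n t)))).
Proof.
move=> bF; have [M FM] := baire_bounded bF.
apply: (@itv_integrable _ (2 ^+ n * M)).
  by apply: section_measurable => //; exact: cube_regularP.
by move=> t; apply: cube_bound => //; exact: baire_upd.
Qed.

Lemma cube_linear n F G (a b : R) : baire F -> baire G ->
  cube_int n (fun x => a * F x + b * G x) = a * cube_int n F + b * cube_int n G.
Proof.
elim: n F G => [|n IH] F G bF bG //=.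
have iF := section_integrable n bF; have iG := section_integrable n bG.
have E : (fun t => cube_int n (fun x => a * F (upd x n t) + b * G (upd x n t)))
   = (fun t => a * cube_int n (fun x => F (upd x n t)) +
               b * cube_int n (fun x => G (upd x n t))).
  by apply/funext => t; rewrite IH //; exact: baire_upd.
rewrite [LHS](_ : _ = Rintegral mu I (fun t => cube_int n (fun x => a * F (upd x n t) + b * G (upd x n t)))) // E.
rewrite RintegralD //; last 2 first.
- by have h := @integrableZl _ _ _ mu I (ltac:(exact: measurable_itv)) a _ iF; exact: h.
- by have h := @integrableZl _ _ _ mu I (ltac:(exact: measurable_itv)) b _ iG; exact: h.
by rewrite RintegralZl // RintegralZl.
Qed.

Lemma cube_le n F G : baire F -> baire G -> (forall x, F x <= G x) ->
  cube_int n F <= cube_int n G.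
Proof.
elim: n F G => [|n IH] F G bF bG FG; first exact: FG.
apply: le_Rintegral => //; try exact: section_integrable.
by move=> t _; apply: IH => //; exact: baire_upd.
Qed.

(** Coordinate 0 is integrated innermost, so finitely many exceptional values of it leave every
    inner integral unchanged, even if they depend on the other coordinates. This is what handles the
    discontinuous integrand that defines the sphere integral. *)
Lemma cube_except n F G (s : (nat -> R) -> seq R) : baire G ->
  (forall x t, t \notin s x -> F (upd x 0%N t) = G (upd x 0%N t)) ->
  cube_int n.+1 F = cube_int n.+1 G.
Proof.
elim: n F G s => [|n IH] F G s bG FG.
  rewrite /=; have [] // := @Rintegral_except (fun t => F (upd (fun=> 0) 0 t))
     (fun t => G (upd (fun=> 0) 0 t)) (s (fun=> 0)).
    by apply: (@section_measurable 0 G) => //; exact: cube_regularP.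
  by move=> t; exact: FG.
apply: eq_Rintegral => t _.
apply: (IH (fun x => F (upd x n.+1 t)) (fun x => G (upd x n.+1 t)) (fun x => s (upd x n.+1 t))).
  exact: baire_upd.
move=> x r rs.
have E : upd (upd x 0 r) n.+1 t = upd (upd x n.+1 t) 0 r.
  by apply/funext => j; rewrite /upd; case: (j =P n.+1) => // ->.
by rewrite E; exact: FG.
Qed.

End CubeIntegral.

(** * Derivatives along sequences and under the integral sign *)

Section DeriveSeq.
Context {R : realType}.

Lemma is_derive_line (V : normedModType R) (f : V -> R) (x v : V) (l : R) :
  is_derive x v f l <-> is_derive (0 : R) (1 : R) (fun h : R => f (h *: v + x)) l.
Proof.
have E : (fun h : R => h^-1 *: ((f \o shift x) (h *: v) - f x)) =
  (fun h : R => h^-1 *: (((fun h : R => f (h *: v + x)) \o shift 0) (h *: 1) - f (0 *: v + x))).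
  by apply/funext => h /=; rewrite addr0 scale0r add0r /GRing.scale /= mulr1.
by split=> -[d e]; split; rewrite /derivable /derive ?E // -E.
Qed.

Lemma is_derive_cvgP (f : R -> R) (t l : R) :
  is_derive t 1 f l <-> h^-1 * (f (t + h) - f t) @[h --> 0^'] --> l.
Proof.
have E : (fun h : R => h^-1 *: ((f \o shift t) (h *: 1) - f t)) =
         (fun h : R => h^-1 * (f (t + h) - f t)).
  by apply/funext => h /=; rewrite /GRing.scale /= mulr1 [t + h]addrC.
split=> [[]|].
  rewrite /derivable /derive E => c <-. exact: c.
move=> h; split; rewrite /derivable /derive E; first by apply/cvg_ex; exists l.
exact: cvg_lim.
Qed.

Lemma is_derive_seqP (f : R -> R) (t l : R) :
  is_derive t 1 f l <->
  (forall u : nat -> R, (forall m, u m != 0) -> u m @[m --> \oo] --> 0 ->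
     (u m)^-1 * (f (t + u m) - f t) @[m --> \oo] --> l).
Proof.
rewrite is_derive_cvgP; split=> [/cvgr_dnbhsP h u u0 uc|h].
  by apply: h.
by apply/cvgr_dnbhsP => u [u0 uc]; exact: h.
Qed.

Lemma is_derive_cont (f : R -> R) (t l : R) : is_derive t 1 f l -> {for t, continuous f}.
Proof. by case=> d _; apply: differentiable_continuous; apply/derivable1_diffP. Qed.

Lemma is_derive_near (f g : R -> R) (t l : R) : (\forall s \near t, f s = g s) ->
  is_derive t 1 f l -> is_derive t 1 g l.
Proof. exact: near_eq_is_derive. Qed.

(* Increments are bounded by the mean value theorem, so dominated convergence applies to the difference quotients. *)
Lemma derive_under (A : Type) (D : set A) (ok : (A -> R) -> Prop) (L : (A -> R) -> R)
  (okL : forall F G a b, ok F -> ok G -> ok (fun x => a * F x + b * G x))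
  (linL : forall F G a b, ok F -> ok G ->
     L (fun x => a * F x + b * G x) = a * L F + b * L G)
  (dctL : forall (Fs : nat -> A -> R) F (M : R), (forall m, ok (Fs m)) -> ok F ->
     (forall m x, D x -> `|Fs m x| <= M) ->
     (forall x, D x -> Fs m x @[m --> \oo] --> F x) ->
     L (Fs m) @[m --> \oo] --> L F)
  (K K' : R -> A -> R) (t0 e M : R) : 0 < e ->
  (forall t, `|t - t0| < e -> ok (K t)) -> ok (K' t0) ->
  (forall t x, `|t - t0| < e -> D x ->
     is_derive t 1 (fun s => K s x) (K' t x) /\ `|K' t x| <= M) ->
  is_derive t0 1 (fun t => L (K t)) (L (K' t0)).
Proof.
move=> e0 okK okK' dK; apply/is_derive_seqP => u u0 uc.
have [N _ hN] : \forall m \near \oo, `|u m| < e.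
  by have /cvgr0Pnorm_lt := uc; apply.
rewrite -(cvg_shiftn N).
have u_lt m : `|u (m + N)%N| < e by apply: hN; rewrite /= leq_addl.
pose Q m x := (u (m + N)%N)^-1 * K (t0 + u (m + N)%N) x + (- (u (m + N)%N)^-1) * K t0 x.
have okt0 : ok (K t0) by apply: okK; rewrite subrr normr0.
have okt m : ok (K (t0 + u (m + N)%N)) by apply: okK; rewrite addrC addKr.
have -> : [sequence (u (n + N)%N)^-1 * (L (K (t0 + u (n + N)%N)) - L (K t0))]_n =
          (fun m => L (Q m)).
  by apply/funext => m /=; rewrite linL // mulrBr mulNr.
have QE m x : Q m x = (u (m + N)%N)^-1 * (K (t0 + u (m + N)%N) x - K t0 x).
  by rewrite /Q mulrBr mulNr.
apply: (dctL _ _ M) => //.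
- by move=> m; apply: okL.
- move=> m x Dx; rewrite QE normrM normfV ler_pdivrMl ?normr_gt0 //.
  have MVTab a b : a < b -> `|a - t0| < e -> `|b - t0| < e -> `|K b x - K a x| <= `|b - a| * M.
    move=> ab ha hb.
    have hc c : c \in `[a, b] -> `|c - t0| < e.
      rewrite in_itv /= => /andP[ac cb].
      by move: ha hb; rewrite !ltr_norml => /andP[? ?] /andP[? ?]; apply/andP; split; lra.
    have [c hc1 ->] := @MVT R (fun s => K s x) (fun s => K' s x) a b ab
      (fun c cab => (dK c x (hc c (subset_itv_oo_cc cab)) Dx).1)
      (@derivable_within_continuous _ _ _ _ (fun c cab => @ex_derive _ _ _ _ _ _ _ (dK c x (hc c cab) Dx).1)).
    rewrite normrM mulrC ler_wpM2l //.
    by apply: (dK _ _ _ Dx).2; apply: hc; apply: subset_itv_oo_cc.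
  have h0 : `|t0 - t0| < e by rewrite subrr normr0.
  have h1 : `|t0 + u (m + N)%N - t0| < e by rewrite addrC addKr.
  have : t0 + u (m + N)%N != t0 by rewrite -subr_eq0 addrC addKr.
  rewrite neq_lt => /orP[lt|lt].
    by rewrite distrC; apply: le_trans (MVTab _ _ lt h1 h0) _; rewrite distrC addrC addKr.
  by apply: le_trans (MVTab _ _ lt h0 h1) _; rewrite addrC addKr.
- move=> x Dx.
  have h0 : `|t0 - t0| < e by rewrite subrr normr0.
  have /is_derive_seqP h := (dK t0 x h0 Dx).1.
  have -> : (fun m => Q m x) = (fun m => (u (m + N)%N)^-1 * (K (t0 + u (m + N)%N) x - K t0 x)).
    by apply/funext => m; exact: QE.
  apply: h => //.
  by have := uc; rewrite -(cvg_shiftn N).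
Qed.

End DeriveSeq.

(** * Integration by parts on the cube *)

Section CubeFTC.
Context {R : realType}.
Local Notation mu := (@lebesgue_measure R).
Implicit Types (F G : (nat -> R) -> R) (x : nat -> R).

Lemma scont_lin F G a b : scont F -> scont G -> scont (fun x => a * F x + b * G x).
Proof.
move=> cF cG xs x h; apply: cvgD; (apply: cvgM; first exact: cvg_cst).
  exact: cF.
exact: cG.
Qed.

Lemma lin_bound (a b u v Mu Mv : R) : `|u| <= Mu -> `|v| <= Mv ->
  `|a * u + b * v| <= `|a| * Mu + `|b| * Mv.
Proof.
move=> hu hv; apply: le_trans (ler_normD _ _) _; rewrite !normrM.
by apply: lerD; apply: ler_wpM2l.
Qed.

(** Induction on [F], then on [G]: one argument passes to its limit while the other is held fixed
    and enters only through a bound. *)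
Lemma baire_lin F G a b : baire F -> baire G -> baire (fun x => a * F x + b * G x).
Proof.
move=> bF bG; elim: bF => {F} [F M cF FM|Fs F M _ IH FM cF].
  elim: bG => {G} [G N cG GN|Gs G N _ IH GN cG].
    apply: (@baire_cont _ _ (`|a| * M + `|b| * N)); first exact: scont_lin.
    by move=> x; apply: lin_bound.
  apply: (@baire_lim _ (fun m x => a * F x + b * Gs m x) _ (`|a| * M + `|b| * N)) => //.
    by move=> m x; apply: lin_bound.
  move=> x; apply: cvgD; apply: cvgM; try exact: cvg_cst.
  exact: cG.
have [N GN] := baire_bounded bG.
apply: (@baire_lim _ (fun m x => a * Fs m x + b * G x) _ (`|a| * M + `|b| * N)) => //.
  by move=> m x; apply: lin_bound.
move=> x; apply: cvgD; apply: cvgM; try exact: cvg_cst.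
exact: cF.
Qed.

Lemma FTC_zero (f f' : R -> R) : (forall t : R, is_derive t (1 : R) f (f' t)) ->
  (forall t : R, {for t, continuous f'}) -> f 1 = f (-1) ->
  Rintegral mu `[-1, 1] f' = 0.
Proof.
move=> df cf' fb.
rewrite /Rintegral (@continuous_FTC2 _ f' f).
- by rewrite fb -EFinB subrr.
- by lra.
- by apply: continuous_subspaceT => t; exact: cf'.
- split.
  + by move=> t _; exact: (@ex_derive _ _ _ _ _ _ _ (df t)).
  + by apply: cvg_at_right_filter; exact: is_derive_cont (df _).
  + by apply: cvg_at_left_filter; exact: is_derive_cont (df _).
- by move=> t _; rewrite derive1E; exact: (@derive_val _ _ _ _ _ _ _ (df t)).
Qed.

Lemma updC x i j s t : i != j -> upd (upd x i s) j t = upd (upd x j t) i s.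
Proof.
move=> ij; apply/funext => k; rewrite /upd; case: eqP => // ->.
by rewrite eq_sym (negbTE ij).
Qed.

Lemma Rintegral_zero : Rintegral mu `[-1, 1] (fun=> 0 : R) = 0.
Proof. by rewrite Rintegral_cst // mul0r. Qed.

Lemma cube_int0 n F : (forall x, F x = 0) -> cube_int n F = 0.
Proof.
move=> F0; have -> : F = (fun=> 0) by apply/funext.
elim: n {F F0} => // n IH /=.
by rewrite -[RHS]Rintegral_zero; apply: eq_Rintegral.
Qed.

(** If [j] is the outermost variable, the inner integral of [H] is a primitive of that of [H'] and
    vanishes at both ends. Otherwise the inner integral of [H'] is zero for each outer value, by
    induction. *)
Lemma cube_int_derive n j H H' (M : R) : (j < n)%N -> scont H -> scont H' ->
  (forall x, `|H x| <= M) -> (forall x, `|H' x| <= M) ->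
  (forall x (t : R), is_derive t (1 : R) (fun s => H (upd x j s)) (H' (upd x j t))) ->
  (forall x, `|x j| = 1 -> H x = 0) -> cube_int n H' = 0.
Proof.
elim: n H H' => // n IH H H' jn cH cH' HM HM' dH H0 /=.
have bH t : baire (fun x => H (upd x n t)).
  by apply: baire_upd; exact: baire_cont HM.
have bH' t : baire (fun x => H' (upd x n t)).
  by apply: baire_upd; exact: baire_cont HM'.
have [jE|jn'] := eqVneq j n; last first.
  have {}jn' : (j < n)%N by rewrite ltn_neqAle jn' -ltnS.
  rewrite -[RHS]Rintegral_zero.
  apply: eq_Rintegral => t _.
  have nj : n != j by rewrite gtn_eqF.
  apply: (IH (fun x => H (upd x n t)) (fun x => H' (upd x n t))) => //.
  - exact: scont_upd.
  - exact: scont_upd.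
  - move=> x s; rewrite updC 1?eq_sym //.
    have -> : (fun s0 => H (upd (upd x j s0) n t)) = (fun s0 => H (upd (upd x n t) j s0)).
      by apply/funext => s0; rewrite updC 1?eq_sym.
    exact: dH.
  - by move=> x xj; apply: H0; rewrite /upd eq_sym (negbTE nj).
subst j.
apply: (FTC_zero (f := fun t => cube_int n (fun x => H (upd x n t)))).
- move=> t.
  apply: (@derive_under _ _ setT baire (cube_int n) _ _ _
    (fun t x => H (upd x n t)) (fun t x => H' (upd x n t)) t 1 M) => //.
  + by move=> F G a b; exact: baire_lin.
  + by move=> F G a b; exact: cube_linear.
  + move=> Fs F N bFs _ FN cF; apply: (cube_cvg (M := N)) => //.
      by move=> m x; exact: FN.
    by move=> x; exact: cF.
- move=> t; apply: continuous_seq => u ut; apply: (cube_cvg (M := M)) => //.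
    by move=> m; exact: bH'.
  by move=> x; apply: (cH' (fun m => upd x n (u m))); apply: upd_cvg => // i; exact: cvg_cst.
- by rewrite !cube_int0 // => x; apply: H0; rewrite /upd eqxx ?normrN ?normr1.
Qed.

End CubeFTC.

(** * Continuously differentiable functions *)

Section Gradients.
Context {R : realType}.

Lemma cvg_sumr (T : Type) (Fi : set_system T) (FF : Filter Fi) (J : Type) (s : seq J)
    (f : J -> T -> R) (l : J -> R) :
  (forall i, f i t @[t --> Fi] --> l i) ->
  \sum_(i <- s) f i t @[t --> Fi] --> \sum_(i <- s) l i.
Proof.
move=> h; elim: s => [|i s IH].
  by rewrite big_nil (_ : (fun=> _) = cst 0); [exact: cvg_cst|apply/funext => t; rewrite big_nil].
rewrite big_cons (_ : (fun t => _) = (fun t => f i t + \sum_(j <- s) f j t)).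
  by apply: cvgD.
by apply/funext => t; rewrite big_cons.
Qed.

Lemma der_add (V : normedModType R) (f g : V -> R) x v a b :
  is_derive x v f a -> is_derive x v g b -> is_derive x v (fun y => f y + g y) (a + b).
Proof. by move=> hf hg; have := is_deriveD hf hg. Qed.

Lemma der_mul (V : normedModType R) (f g : V -> R) x v a b :
  is_derive x v f a -> is_derive x v g b ->
  is_derive x v (fun y => f y * g y) (a * g x + f x * b).
Proof.
move=> hf hg; apply: (is_derive_eq (is_deriveM hf hg)).
by rewrite /GRing.scale /= addrC [g x * a]mulrC.
Qed.

Lemma der_cst (V : normedModType R) (c : R) (x v : V) : is_derive x v (fun=> c) (0 : R).
Proof. exact: is_derive_cst. Qed.

Lemma der_sum (V : normedModType R) (J : Type) (s : seq J) (f : J -> V -> R) x v l :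
  (forall i, is_derive x v (f i) (l i)) ->
  is_derive x v (fun y => \sum_(i <- s) f i y) (\sum_(i <- s) l i).
Proof.
move=> h; elim: s => [|i s IH].
  rewrite big_nil (_ : (fun=> _) = fun=> 0); last by apply/funext => y; rewrite big_nil.
  exact: der_cst.
rewrite big_cons (_ : (fun y => _) = (fun y => f i y + \sum_(j <- s) f j y)).
  exact: der_add.
by apply/funext => y; rewrite big_cons.
Qed.

Lemma der_unique (V : normedModType R) (f : V -> R) x v a b :
  is_derive x v f a -> is_derive x v f b -> a = b.
Proof. by move=> [_ <-] [_ <-]. Qed.

Lemma MVT_between (f f' : R -> R) (h : R) :
  (forall s : R, `|s| <= `|h| -> is_derive s (1 : R) f (f' s)) ->
  exists2 c, `|c| <= `|h| & f h - f 0 = f' c * h.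
Proof.
move=> df.
have M a b : a < b -> `|a| <= `|h| -> `|b| <= `|h| ->
    exists2 c, `|c| <= `|h| & f b - f a = f' c * (b - a).
  move=> ab ha hb.
  have hc c : c \in `[a, b] -> `|c| <= `|h|.
    rewrite in_itv /= => /andP[ac cb].
    by move: ha hb; rewrite !ler_norml => /andP[? ?] /andP[? ?]; apply/andP; split; lra.
  have [c hc1 ->] := @MVT R f f' a b ab
    (fun c cab => (df c (hc c (subset_itv_oo_cc cab))))
    (@derivable_within_continuous _ _ _ _ (fun c cab => @ex_derive _ _ _ _ _ _ _ (df c (hc c cab)))).
  by exists c => //; apply: hc; exact: subset_itv_oo_cc.
have [h0|h0|h0] := ltgtP h 0.
- have [||c hc e] := M h 0 h0; [by []|by rewrite normr0|].
  by exists c => //; rewrite -opprB e; ring.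
- have [||c hc e] := M 0 h h0; [by rewrite normr0|by []|].
  by exists c => //; rewrite e; ring.
- by exists 0; rewrite h0 ?normr0 // subrr mulr0.
Qed.

Lemma filter_all (T : Type) (J : finType) (Fi : set_system T) (FF : Filter Fi)
    (P : J -> T -> Prop) :
  (forall i, Fi (P i)) -> Fi (fun t => forall i, P i t).
Proof.
by move=> h; have H := @filter_forall _ _ (fun i => P i : set T) Fi FF h; apply: filterS H.
Qed.

Variable d : nat.
Implicit Types (G : set 'rV[R]_d) (u w : 'rV[R]_d -> R) (x y : 'rV[R]_d).

Definition has_grad G u (du : 'I_d -> 'rV[R]_d -> R) :=
  forall x, G x -> forall i, is_derive x (evec i) u (du i x) /\ {for x, continuous (du i)}.

Lemma rV_nbhs x (P : set 'rV[R]_d) : nbhs x P <->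
  exists2 e : R, 0 < e & forall y, (forall i, `|y 0 i - x 0 i| < e) -> P y.
Proof.
split=> [/nbhs_ballP[e /= e0 h]|[e e0 h]].
  exists e => // y hy; apply: h; split => // i j.
  by rewrite ord1 /ball /= distrC.
apply/nbhs_ballP; exists e => // y [_ hy]; apply: h => i.
by have := hy 0 i; rewrite /ball /= distrC.
Qed.

Lemma line_coord x (i j : 'I_d) (h : R) :
  (h *: evec i + x : 'rV[R]_d) 0 j = x 0 j + (if j == i then h else 0).
Proof.
rewrite !mxE eqxx /= addrC; congr (_ + _).
by case: eqP => _; rewrite /= ?mulr1 ?mulr0.
Qed.

Lemma is_derive_shift u x v (s l : R) : is_derive (s *: v + x) v u l ->
  is_derive s 1 (fun r : R => u (r *: v + x)) l.
Proof.
move=> /is_derive_line/is_derive_cvgP h; apply/is_derive_cvgP.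
rewrite (_ : (fun h => _) = (fun h => h^-1 * (u ((0 + h) *: v + (s *: v + x)) - u (0 *: v + (s *: v + x))))) //.
by apply/funext => r; rewrite add0r scale0r add0r addrA -scalerDl [r + s]addrC.
Qed.

(** First-order expansion from continuous partial derivatives: moving from [x] to [y] one coordinate
    at a time, each move is governed by the one-variable mean value theorem. *)
Lemma grad_incr G u du x (e : R) : open G -> has_grad G u du -> G x -> 0 < e ->
  exists2 r : R, 0 < r & forall y, (forall i, `|y 0 i - x 0 i| < r) ->
    `|u y - u x - \sum_i du i x * (y 0 i - x 0 i)| <= e * \sum_i `|y 0 i - x 0 i|.
Proof.
move=> oG hG Gx e0.
have : \forall y \near x, G y /\ forall i, `|du i y - du i x| <= e.
  have n1 : \forall y \near x, G y by exact: open_nbhs_nbhs.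
  suff n2 : \forall y \near x, forall i, `|du i y - du i x| <= e by exact: filterI n1 n2.
  apply: filter_all => i.
  have [_ /cvgrPdist_le /(_ e e0)] := hG x Gx i.
  by apply: filterS => y; rewrite distrC.
move=> /rV_nbhs[r r0 hr]; exists r => // y hy.
(* The [k]-th corner of the path has its first [k] coordinates from [y] and the others from [x]. *)
pose z k : 'rV[R]_d := \row_i (if (i < k)%N then y 0 i else x 0 i).
have zd : z d = y by apply/rowP => i; rewrite mxE ltn_ord.
have z0 : z 0%N = x by apply/rowP => i; rewrite mxE.
have zS (i : 'I_d) : z i.+1 = (y 0 i - x 0 i) *: evec i + z i.
  apply/rowP => j; rewrite line_coord !mxE ltnS leq_eqVlt.
  rewrite [(j == i :> nat)](_ : _ = (j == i)) //.
  by case: eqP => [->|_]; rewrite ?ltnn /= ?addr0 //; ring.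
have -> : u y - u x = \sum_(i < d) (u (z i.+1) - u (z i)).
  by rewrite -(big_mkord xpredT (fun i => u (z i.+1) - u (z i))) telescope_sumr // zd z0.
rewrite -sumrB mulr_sumr; apply: le_trans (ler_norm_sum _ _ _) _.
apply: ler_sum => i _; set h := y 0 i - x 0 i.
have near s : `|s| <= `|h| -> G (s *: evec i + z i) /\
     forall j, `|du j (s *: evec i + z i) - du j x| <= e.
  move=> sh; apply: hr => j; rewrite line_coord mxE.
  have [ji|ji] := eqVneq j i.
    by rewrite ji ltnn addrAC subrr add0r; apply: le_lt_trans sh _; exact: hy.
  by rewrite addr0; case: ifP => _; [exact: hy|rewrite subrr normr0].
have [s sh E] := @MVT_between (fun s => u (s *: evec i + z i))
   (fun s => du i (s *: evec i + z i)) h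
   (fun s hs => is_derive_shift (hG _ (near s hs).1 i).1).
have -> : u (z i.+1) - u (z i) = du i (s *: evec i + z i) * h.
  by rewrite zS -E scale0r add0r.
rewrite -mulrBl normrM.
by apply: ler_wpM2r => //; exact: (near s sh).2.
Qed.

Lemma has_grad_continuous G u du x : open G -> has_grad G u du -> G x ->
  {for x, continuous u}.
Proof.
move=> oG hG Gx; apply/(@cvgrPdist_le _ _ _ (nbhs x)) => e e0.
have [r r0 hr] := grad_incr oG hG Gx ltr01.
(* The coefficients [|du i x| + 1] come from [grad_incr] with error factor 1; the leading 1 keeps
   [S] positive in dimension 0. *)
pose S := 1 + \sum_i (`|du i x| + 1).
have S0 : 0 < S by rewrite ltr_wpDr // sumr_ge0 // => i _; rewrite addr_ge0.
apply/rV_nbhs; exists (Num.min r (e / S)); first by rewrite lt_min r0 divr_gt0.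
move=> y hy; rewrite distrC.
have h1 i : `|y 0 i - x 0 i| < r by have := hy i; rewrite lt_min => /andP[].
have h2 i : `|y 0 i - x 0 i| <= e / S.
  by have := hy i; rewrite lt_min => /andP[_ /ltW].
rewrite -(subrK (\sum_i du i x * (y 0 i - x 0 i)) (u y - u x)).
apply: le_trans (ler_normD _ _) _.
apply: (@le_trans _ _ (\sum_i (`|du i x| + 1) * `|y 0 i - x 0 i|)).
  have -> : \sum_i (`|du i x| + 1) * `|y 0 i - x 0 i| =
     1 * \sum_i `|y 0 i - x 0 i| + \sum_i `|du i x| * `|y 0 i - x 0 i|.
    by rewrite mul1r -big_split /=; apply: eq_bigr => i _; rewrite mulrDl mul1r addrC.
  apply: lerD; first exact: hr.
  by apply: le_trans (ler_norm_sum _ _ _) _; apply: ler_sum => i _; rewrite normrM.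
apply: (@le_trans _ _ (\sum_(i < d) (`|du i x| + 1) * (e / S))).
  by apply: ler_sum => i _; apply: ler_wpM2l => //; rewrite addr_ge0.
rewrite -mulr_suml mulrCA -[leRHS]mulr1; apply: ler_wpM2l; first exact: ltW.
by rewrite ler_pdivrMr // mul1r /S; lra.
Qed.

(** The difference quotients of the coordinates are eventually bounded in sum by [S], so [grad_incr]
    with factor [e / S] leaves an error of at most [e]. *)
Lemma chain_rule G u du (c : R -> 'rV[R]_d) (c' : 'I_d -> R) (t : R) :
  open G -> has_grad G u du -> G (c t) ->
  (forall i, is_derive t (1 : R) (fun s => c s 0 i) (c' i)) ->
  is_derive t 1 (fun s => u (c s)) (\sum_i du i (c t) * c' i).
Proof.
move=> oG hG Gx dc; apply/is_derive_seqP => h h0 hc.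
pose q m i := (h m)^-1 * (c (t + h m) 0 i - c t 0 i).
have qc i : q m i @[m --> \oo] --> c' i.
  by have /is_derive_seqP := dc i; apply.
have sc : \sum_i du i (c t) * q m i @[m --> \oo] --> \sum_i du i (c t) * c' i.
  by apply: cvg_sumr => i; apply: cvgM => //; exact: cvg_cst.
have ab : \sum_i `|q m i| @[m --> \oo] --> \sum_i `|c' i|.
  by apply: cvg_sumr => i; apply: cvg_norm.
pose S := 1 + \sum_i `|c' i|.
have S0 : 0 < S by rewrite ltr_wpDr // sumr_ge0.
rewrite -[X in _ --> X]add0r.
rewrite (_ : (fun m => _) = (fun m =>
  ((h m)^-1 * (u (c (t + h m)) - u (c t)) - \sum_i du i (c t) * q m i)
  + \sum_i du i (c t) * q m i)); last by apply/funext => m; rewrite subrK.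
apply: cvgD => //; apply/cvgr0Pnorm_le => e e0.
have [r r0 hr] := grad_incr oG hG Gx (divr_gt0 e0 S0).
have nearS : \forall m \near \oo, \sum_i `|q m i| <= S.
  apply: (cvgr_le _ ab); rewrite /S; lra.
have nearc : \forall m \near \oo, forall i, `|c (t + h m) 0 i - c t 0 i| < r.
  apply: filter_all => i.
  have ht : t + h m @[m --> \oo] --> t.
    by rewrite -[X in _ --> X]addr0; apply: cvgD => //; exact: cvg_cst.
  have H := cvg_comp _ _ ht (is_derive_cont (dc i)).
  have /cvgrPdist_lt /(_ r r0) := H.
  by apply: filterS => m; rewrite distrC.
near=> m.
have hm : \sum_i `|q m i| <= S by near: m.
have hi : forall i, `|c (t + h m) 0 i - c t 0 i| < r by near: m.
have -> : \sum_i du i (c t) * q m i =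
   (h m)^-1 * \sum_i du i (c t) * (c (t + h m) 0 i - c t 0 i).
  by rewrite mulr_sumr; apply: eq_bigr => i _; rewrite /q mulrCA.
rewrite -mulrBr normrM.
apply: (@le_trans _ _ (`|(h m)^-1| * (e / S * \sum_i `|c (t + h m) 0 i - c t 0 i|))).
  by apply: ler_wpM2l => //; exact: hr.
rewrite mulrCA mulr_sumr.
apply: (@le_trans _ _ (e / S * S)); last by rewrite divfK // gt_eqF.
apply: ler_wpM2l; first by rewrite divr_ge0 ?ltW.
by apply: le_trans hm; apply: ler_sum => i _; rewrite /q normrM.
Unshelve. all: by end_near. Qed.

End Gradients.

Section Smoothness.
Context {R : realType}.
Variable d : nat.
Implicit Types (G : set 'rV[R]_d) (u w : 'rV[R]_d -> R) (x y : 'rV[R]_d).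

Lemma cont_add x u w : {for x, continuous u} -> {for x, continuous w} ->
  {for x, continuous (fun y => u y + w y)}.
Proof. by move=> cu cw; exact: (cvgD cu cw). Qed.

Lemma cont_mul x u w : {for x, continuous u} -> {for x, continuous w} ->
  {for x, continuous (fun y => u y * w y)}.
Proof. by move=> cu cw; exact: (cvgM cu cw). Qed.

Lemma hg_ext G u w du dw : open G -> (forall x, G x -> u x = w x) ->
  (forall x i, G x -> du i x = dw i x) -> has_grad G u du -> has_grad G w dw.
Proof.
move=> oG uw duw h x Gx i; have [h1 h2] := h x Gx i.
have n1 : \forall y \near x, G y by exact: open_nbhs_nbhs.
split.
  rewrite -duw //; apply: near_eq_is_derive h1.
  by apply: filterS n1 => y; exact: uw.
have E : du i x = dw i x by exact: duw.
suff : dw i y @[y --> x] --> dw i x by [].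
rewrite -E; apply: cvg_trans h2.
by apply: (@near_eq_cvg _ _ (nbhs x)); apply: filterS n1 => y Gy; rewrite duw.
Qed.

Lemma hg_add G u w du dw : has_grad G u du -> has_grad G w dw ->
  has_grad G (fun x => u x + w x) (fun i x => du i x + dw i x).
Proof.
move=> hu hw x Gx i; have [? ?] := hu x Gx i; have [? ?] := hw x Gx i.
by split; [exact: der_add|exact: cont_add].
Qed.

Lemma hg_mul G u w du dw : open G -> has_grad G u du -> has_grad G w dw ->
  has_grad G (fun x => u x * w x) (fun i x => du i x * w x + u x * dw i x).
Proof.
move=> oG hu hw x Gx i; have [? ?] := hu x Gx i; have [? ?] := hw x Gx i.
have cu := has_grad_continuous oG hu Gx; have cw := has_grad_continuous oG hw Gx.
by split; [exact: der_mul|apply: cont_add; exact: cont_mul].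
Qed.

Lemma hg_cst G (c : R) : has_grad G (fun=> c) (fun _ _ => 0).
Proof. by move=> x _ i; split; [exact: der_cst|exact: cst_continuous]. Qed.

Lemma hg_coord G (j : 'I_d) : has_grad G (fun x => x 0 j) (fun i _ => (i == j)%:R).
Proof.
move=> x _ i; split; last exact: cst_continuous.
apply/is_derive_line.
rewrite (_ : (fun h : R => _) = (fun h => x 0 j + (i == j)%:R * h)); last first.
  apply/funext => h; rewrite line_coord eq_sym.
  by case: eqP => _; rewrite ?mul1r ?mul0r.
apply: (is_derive_eq (der_add (der_cst _ _ _) (der_mul (der_cst _ _ _) (is_derive_id _ _)))).
by rewrite mul0r !add0r mulr1.
Qed.

Lemma hg_sum G (J : Type) (s : seq J) (u : J -> 'rV[R]_d -> R) du :
  (forall k, has_grad G (u k) (du k)) ->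
  has_grad G (fun x => \sum_(k <- s) u k x) (fun i x => \sum_(k <- s) du k i x).
Proof.
move=> h x Gx i; split; first by apply: der_sum => k; exact: (h k x Gx i).1.
by exact: (@cvg_sumr _ _ (nbhs x) _ _ s (fun k y => du k i y) _ (fun k => (h k x Gx i).2)).
Qed.

(** C^n regularity with existentially chosen gradients: they matter on [G] only, so explicit
    formulas can serve as witnesses in place of ['D_]. *)
Fixpoint Cn n G u : Prop :=
  if n is n'.+1 then exists2 du, has_grad G u du & forall i, Cn n' G (du i)
  else forall x, G x -> {for x, continuous u}.

Lemma Cn_cont n G u x : open G -> Cn n G u -> G x -> {for x, continuous u}.
Proof.
move=> oG; case: n => [|n] /=; first exact.
by move=> [du h _]; exact: has_grad_continuous oG h.
Qed.

Lemma CnS n G u : open G -> Cn n.+1 G u -> Cn n G u.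
Proof.
move=> oG; elim: n u => [|n IH] u [du h c] /=; first by move=> x; exact: has_grad_continuous oG h.
by exists du => // i; apply: IH; exact: c.
Qed.

Lemma Cn_ext n G u w : open G -> (forall x, G x -> u x = w x) -> Cn n G u -> Cn n G w.
Proof.
move=> oG uw; case: n => [|n] /=.
  move=> c x Gx; have n1 : \forall y \near x, G y by exact: open_nbhs_nbhs.
  suff : w y @[y --> x] --> w x by [].
  rewrite -uw //; apply: cvg_trans (c x Gx).
  by apply: (@near_eq_cvg _ _ (nbhs x)); apply: filterS n1 => y Gy; rewrite uw.
by move=> [du h c]; exists du => //; exact: hg_ext h.
Qed.

Lemma Cn_add n G u w : Cn n G u -> Cn n G w -> Cn n G (fun x => u x + w x).
Proof.
elim: n u w => [|n IH] u w /=.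
  by move=> cu cw x Gx; apply: cont_add; [exact: cu|exact: cw].
move=> [du hu cu] [dw hw cw]; exists (fun i x => du i x + dw i x); first exact: hg_add.
by move=> i; apply: IH.
Qed.

Lemma Cn_mul n G u w : open G -> Cn n G u -> Cn n G w -> Cn n G (fun x => u x * w x).
Proof.
move=> oG; elim: n u w => [|n IH] u w.
  by move=> cu cw x Gx; apply: cont_mul; [exact: cu|exact: cw].
move=> Cu Cw; have Cu' := CnS oG Cu; have Cw' := CnS oG Cw.
case: Cu => du hu cu; case: Cw => dw hw cw.
exists (fun i x => du i x * w x + u x * dw i x); first exact: hg_mul.
by move=> i; apply: Cn_add; [exact: IH (cu i) Cw'|exact: IH Cu' (cw i)].
Qed.

Lemma Cn_cst n G (c : R) : Cn n G (fun=> c).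
Proof.
elim: n c => [|n IH] c /=; first by move=> x _; exact: cst_continuous.
by exists (fun _ _ => 0); [exact: hg_cst|move=> i; exact: IH].
Qed.

Lemma Cn_coord n G (j : 'I_d) : Cn n G (fun x => x 0 j).
Proof.
case: n => [|n]; first by move=> x _; exact: coord_continuous.
by exists (fun i _ => (i == j)%:R); [exact: hg_coord|move=> i; exact: Cn_cst].
Qed.

Lemma Cn_sum n G (J : Type) (s : seq J) (u : J -> 'rV[R]_d -> R) :
  (forall k, Cn n G (u k)) -> Cn n G (fun x => \sum_(k <- s) u k x).
Proof.
move=> h; elim: s => [|k s IH].
  by rewrite (_ : (fun=> _) = fun=> 0); [exact: Cn_cst|apply/funext => x; rewrite big_nil].
rewrite (_ : (fun x => _) = (fun x => u k x + \sum_(j <- s) u j x)).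
  exact: Cn_add.
by apply/funext => x; rewrite big_cons.
Qed.

Lemma Cn_prod n G (J : Type) (s : seq J) (u : J -> 'rV[R]_d -> R) : open G ->
  (forall k, Cn n G (u k)) -> Cn n G (fun x => \prod_(k <- s) u k x).
Proof.
move=> oG h; elim: s => [|k s IH].
  by rewrite (_ : (fun=> _) = fun=> 1); [exact: Cn_cst|apply/funext => x; rewrite big_nil].
rewrite (_ : (fun x => _) = (fun x => u k x * \prod_(j <- s) u j x)).
  exact: Cn_mul.
by apply/funext => x; rewrite big_cons.
Qed.

Lemma Cn_exp n G u k : open G -> Cn n G u -> Cn n G (fun x => u x ^+ k).
Proof.
move=> oG cu; elim: k => [|k IH].
  by rewrite (_ : (fun=> _) = fun=> 1); [exact: Cn_cst|apply/funext => x; rewrite expr0].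
rewrite (_ : (fun x => _) = (fun x => u x * u x ^+ k)); first exact: Cn_mul.
by apply/funext => x; rewrite exprS.
Qed.

Lemma smoothR_Cn G u n : smoothR G u -> Cn n G u.
Proof.
move=> [cu du]; suff : forall ls, Cn n G (Defs.iterD ls u) by move/(_ [::]).
elim: n => [|n IH] ls; first by move=> x; exact: cu.
exists (fun i => Defs.iterD (i :: ls) u); last by move=> i; exact: IH.
by move=> x Gx i; split; [apply: derivableP; exact: du|exact: cu].
Qed.

(** [lapR] differentiates the globally defined ['D_]; as [G] is open, each derivative at a point of
    [G] depends on values in [G] only and so agrees with the witness. *)
Lemma Cn_laplacian G u n : open G -> Cn n.+2 G u ->
  exists du ddu, [/\ has_grad G u du, forall i, has_grad G (du i) (ddu i),
     forall i j, Cn n G (ddu i j) & forall x, G x -> lapR u x = \sum_i ddu i i x].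
Proof.
move=> oG [du hu /= /(_ _)/cid2-/all_sig2[ddu hd cd]].
exists du, ddu; split => // x Gx; apply: eq_bigr => i _.
have n1 : \forall y \near x, G y by exact: open_nbhs_nbhs.
have [_ <-] := (hd i x Gx i).1.
apply: near_eq_derive; apply: filterS n1 => y Gy.
by have [[_ <-] _] := hu y Gy i.
Qed.

Lemma Cn_lapR G u n : open G -> Cn n.+2 G u -> Cn n G (lapR u).
Proof.
move=> oG /(Cn_laplacian oG)[du [ddu [_ _ cd e]]].
apply: (@Cn_ext _ _ (fun x => \sum_i ddu i i x)) => //; last exact: Cn_sum.
by move=> x Gx; rewrite e.
Qed.

Lemma Cn_iter_lapR G u p n : open G -> (forall m, Cn m G u) -> Cn n G (iter p lapR u).
Proof.
by move=> oG cu; elim: p n => [|p IH] n //=; apply: Cn_lapR.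
Qed.

End Smoothness.

(** * The Euclidean norm and annuli *)

Section Enorm.
Context {R : realType}.
Variable d : nat.
Implicit Types (x y : 'rV[R]_d).

Lemma enorm_ge0 x : 0 <= enorm x. Proof. exact: sqrtr_ge0. Qed.

Lemma enorm_sqr x : enorm x ^+ 2 = \sum_(i < d) x 0 i ^+ 2.
Proof. by rewrite sqr_sqrtr // sumr_ge0 // => i _; exact: sqr_ge0. Qed.

Lemma enormZ (a : R) x : enorm (a *: x) = `|a| * enorm x.
Proof.
rewrite /enorm -sqrtr_sqr -sqrtrM ?sqr_ge0 // mulr_sumr; congr Num.sqrt.
by apply: eq_bigr => i _; rewrite mxE exprMn.
Qed.

Lemma coord_le_enorm x i : `|x 0 i| <= enorm x.
Proof.
rewrite -sqrtr_sqr ler_sqrt ?sumr_ge0 // => [|j _]; last exact: sqr_ge0.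
by rewrite (bigD1 i) //= lerDl sumr_ge0 // => j _; exact: sqr_ge0.
Qed.

Lemma enorm_continuous : continuous (@enorm R d).
Proof.
move=> x.
have h : \sum_(i < d) y 0 i ^+ 2 @[y --> x] --> \sum_(i < d) x 0 i ^+ 2.
  apply: (@cvg_sumr _ _ (nbhs x) _ _ _ (fun i y => y 0 i ^+ 2) (fun i => x 0 i ^+ 2)) => i.
  have hi := @coord_continuous R 1 d 0 i x.
  exact: (cvg_comp _ _ hi (@exprn_continuous R 2 _)).
exact: (cvg_comp _ _ h (@sqrt_continuous R _)).
Qed.

Lemma annulus_open (r0 : R) (r1 : \bar R) : open (@annulus R d r0 r1).
Proof.
have -> : @annulus R d r0 r1 = (@enorm R d) @^-1` ([set t | r0 < t] `&` [set t | (t%:E < r1)%E]).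
  by apply/seteqP; split => x [].
apply: open_comp; first by move=> x _; exact: enorm_continuous.
apply: openI; first exact: open_gt.
case: r1 => [r| |].
- rewrite (_ : [set t | _] = [set t | t < r]); first exact: open_lt.
  by apply/seteqP; split => t /=; rewrite lte_fin.
- rewrite (_ : [set t | _] = setT); first exact: openT.
  by apply/seteqP; split => t //= _; rewrite ltry.
- rewrite (_ : [set t | _] = set0); first exact: open0.
  by apply/seteqP; split => t //=; rewrite ltNge leNye.
Qed.

Lemma annulus_compact (a b : R) : compact [set x : 'rV[R]_d | a <= enorm x <= b].
Proof.
apply: bounded_closed_compact.
  exists b; split; first exact: num_real.
  move=> M bM x /andP[_ xb].
  have M0 : 0 <= M by apply: le_trans (ltW bM); apply: le_trans xb; exact: enorm_ge0.
  suff: mx_norm x <= M by []; rewrite mx_normrE; apply/bigmax_leP; split => // -[i j] _ /=.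
  rewrite ord1; apply: le_trans (coord_le_enorm _ _) _.
  exact: le_trans xb (ltW bM).
have -> : [set x : 'rV[R]_d | a <= enorm x <= b] =
   (@enorm R d) @^-1` ([set t | a <= t] `&` [set t | t <= b]).
  by apply/seteqP; split => x /= => [/andP[]|[-> ->]].
apply: preimage_closed; last by apply: closedI; [exact: closed_ge|exact: closed_le].
by move=> x _; exact: enorm_continuous.
Qed.

Lemma compact_bound (K : set 'rV[R]_d) (u : 'rV[R]_d -> R) : compact K ->
  (forall x, K x -> {for x, continuous u}) -> exists M, forall x, K x -> `|u x| <= M.
Proof.
move=> cK cu.
have c : compact (u @` K).
  apply: continuous_compact => //; apply: continuous_in_subspaceT => x.
  by rewrite inE; exact: cu.
have [M [_ h]] := compact_bounded c.
by exists (M + 1) => x Kx; apply: h; [rewrite ltrDl|exists x].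
Qed.

Lemma rV_cvg (xs : nat -> 'rV[R]_d) x :
  (forall i, xs m 0 i @[m --> \oo] --> x 0 i) -> xs m @[m --> \oo] --> x.
Proof.
move=> h P /rV_nbhs[e e0 he].
have H : \forall m \near \oo, forall i, `|xs m 0 i - x 0 i| < e.
  apply: filter_all => i; have /cvgrPdist_lt /(_ e e0) := h i.
  by apply: filterS => m; rewrite distrC.
by apply: filterS H => m; exact: he.
Qed.

End Enorm.

(** * Functions on the sphere and their radial extensions *)

Section SphereClass.
Context {R : realType}.

Lemma cvg_eventually (u v : nat -> R) (l : R) : (\forall m \near \oo, u m = v m) ->
  v m @[m --> \oo] --> l -> u m @[m --> \oo] --> l.
Proof.
by move=> h; apply: cvg_trans; apply: near_eq_cvg; apply: filterS h => m ->.
Qed.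

Variable d : nat.
Implicit Types (g h : 'rV[R]_d -> R) (th : 'rV[R]_d).

(** Only values on the unit sphere are tested, so any formula extending [g] off the sphere is
    admissible; the bound supplies the dominating constant for limits. *)
Definition sphere_cont g :=
  (forall (ths : nat -> 'rV[R]_d) th, (forall m, enorm (ths m) = 1) -> enorm th = 1 ->
     (forall i, ths m 0 i @[m --> \oo] --> th 0 i) -> g (ths m) @[m --> \oo] --> g th) /\
  (exists M, forall th, enorm th = 1 -> `|g th| <= M).

Lemma sphere_cont_of g : (forall th, enorm th = 1 -> {for th, continuous g}) -> sphere_cont g.
Proof.
move=> cg; split.
  move=> ths th _ th1 h; exact: (cvg_comp _ _ (rV_cvg h) (cg th th1)).
have [M hM] : exists M, forall x : 'rV[R]_d, [set x | 1 <= enorm x <= 1] x -> `|g x| <= M.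
  apply: compact_bound; first exact: annulus_compact.
  by move=> x /= h1; apply: cg; apply/eqP; rewrite eq_le andbC.
by exists M => th th1; apply: hM; rewrite /= th1 lexx.
Qed.

Lemma sphere_cont_eq g h : (forall th, enorm th = 1 -> g th = h th) ->
  sphere_cont g -> sphere_cont h.
Proof.
move=> gh [c [M b]]; split; last by exists M => th th1; rewrite -gh //; exact: b.
move=> ths th h1 th1 hc; rewrite -gh //.
by rewrite (_ : (fun m => _) = (fun m => g (ths m))); [exact: c|apply/funext => m; rewrite gh].
Qed.

Lemma sphere_cont_add g h : sphere_cont g -> sphere_cont h -> sphere_cont (fun x => g x + h x).
Proof.
move=> [cg [M bg]] [ch [N bh]]; split.
  by move=> ths th h1 th1 hc; apply: cvgD; [exact: cg|exact: ch].
exists (M + N) => th th1; apply: le_trans (ler_normD _ _) _.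
by apply: lerD; [exact: bg|exact: bh].
Qed.

Lemma sphere_cont_mul g h : sphere_cont g -> sphere_cont h -> sphere_cont (fun x => g x * h x).
Proof.
move=> [cg [M bg]] [ch [N bh]]; split.
  by move=> ths th h1 th1 hc; apply: cvgM; [exact: cg|exact: ch].
exists (M * N) => th th1; rewrite normrM.
by apply: ler_pM => //; [exact: bg|exact: bh].
Qed.

Lemma sphere_cont_cst (c : R) : sphere_cont (fun=> c).
Proof.
split; last by exists `|c|.
by move=> ths th _ _ _; exact: cvg_cst.
Qed.

Lemma sphere_cont_coord (i : 'I_d) : sphere_cont (fun x => x 0 i).
Proof.
split; first by move=> ths th _ _ h; exact: h.
by exists 1 => th <-; exact: coord_le_enorm.
Qed.

Lemma sphere_cont_sum (J : Type) (s : seq J) (g : J -> 'rV[R]_d -> R) :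
  (forall k, sphere_cont (g k)) -> sphere_cont (fun x => \sum_(k <- s) g k x).
Proof.
move=> h; elim: s => [|k s IH].
  by rewrite (_ : (fun=> _) = fun=> 0); [exact: sphere_cont_cst|apply/funext => x; rewrite big_nil].
rewrite (_ : (fun x => _) = (fun x => g k x + \sum_(j <- s) g j x)).
  exact: sphere_cont_add.
by apply/funext => x; rewrite big_cons.
Qed.

Lemma sphere_cont_lin g h a b : sphere_cont g -> sphere_cont h ->
  sphere_cont (fun x => a * g x + b * h x).
Proof.
by move=> cg ch; apply: sphere_cont_add; apply: sphere_cont_mul => //; exact: sphere_cont_cst.
Qed.

Definition vecn (x : nat -> R) : 'rV[R]_d := \row_i x (nat_of_ord i).
Definition dir (x : nat -> R) : 'rV[R]_d := (enorm (vecn x))^-1 *: vecn x.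

Lemma dir_norm x : 0 < enorm (vecn x) -> enorm (dir x) = 1.
Proof. by move=> x0; rewrite enormZ normfV gtr0_norm // mulVf // gt_eqF. Qed.

Lemma enorm_vecn_cvg (xs : nat -> nat -> R) x : (forall j, xs m j @[m --> \oo] --> x j) ->
  enorm (vecn (xs m)) @[m --> \oo] --> enorm (vecn x).
Proof.
move=> h; have hv : vecn (xs m) @[m --> \oo] --> vecn x.
  apply: rV_cvg => i; rewrite mxE (_ : (fun m => _) = (fun m => xs m i)); first exact: h.
  by apply/funext => m; rewrite mxE.
exact: (cvg_comp _ _ hv (@enorm_continuous R d _)).
Qed.

(** The profile takes the squared norm, which is polynomial in the coordinates and hence easy to
    differentiate even at the origin. *)
Definition cutf (kap : R -> R) g (x : nat -> R) : R :=
  kap (enorm (vecn x) ^+ 2) * g (dir x).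

Lemma scont_cutf (kap : R -> R) (a : R) g : 0 < a -> continuous kap ->
  (forall s, s <= a -> kap s = 0) -> sphere_cont g -> scont (cutf kap g).
Proof.
move=> a0 ck k0 [cg _] xs x h.
have hn := enorm_vecn_cvg h.
have hn2 : enorm (vecn (xs m)) ^+ 2 @[m --> \oo] --> enorm (vecn x) ^+ 2.
  exact: (cvg_comp _ _ hn (@exprn_continuous R 2 _)).
have [x0|x0] := eqVneq (enorm (vecn x)) 0.
  rewrite /cutf k0 ?x0 ?expr0n ?ltW // mul0r.
  have : \forall m \near \oo, enorm (vecn (xs m)) ^+ 2 <= a.
    by apply: (cvgr_le _ hn2); rewrite x0 expr0n.
  move=> H; apply: (@cvg_eventually _ (fun=> 0)); last exact: cvg_cst.
  by apply: filterS H => m hm; rewrite k0 // mul0r.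
have {}x0 : 0 < enorm (vecn x) by rewrite lt_neqAle eq_sym x0 enorm_ge0.
apply: cvgM; first exact: (cvg_comp _ _ hn2 (ck _)).
(* The vectors are nonzero only eventually, while [sphere_cont] wants every term on the sphere; the
   early terms are replaced by the limit direction. *)
pose ths m := if 0 < enorm (vecn (xs m)) then dir (xs m) else dir x.
have pos : \forall m \near \oo, 0 < enorm (vecn (xs m)) by exact: (cvgr_gt _ hn).
have hth : g (ths m) @[m --> \oo] --> g (dir x).
  apply: cg.
  - by move=> m; rewrite /ths; case: ifP => // hm; rewrite dir_norm.
  - exact: dir_norm.
  move=> i; apply: (@cvg_eventually _ (fun m => dir (xs m) 0 i)).
    by apply: filterS pos => m hm; rewrite /ths hm.
  rewrite (_ : (fun m => _) = (fun m => (enorm (vecn (xs m)))^-1 * xs m i)); last first.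
    by apply/funext => m; rewrite /dir !mxE.
  rewrite /dir !mxE; apply: cvgM; last exact: h.
  by apply: cvgV => //; rewrite gt_eqF.
apply: cvg_eventually hth.
by apply: filterS pos => m hm; rewrite /ths hm.
Qed.

(** At the origin [dir] is the zero vector, off the sphere, and [kap 0 = 0] takes over. The absolute
    value on [N] covers an empty sphere, where [N] could be negative. *)
Lemma cutf_bound (kap : R -> R) g (M N : R) : (forall s, `|kap s| <= M) -> kap 0 = 0 ->
  (forall th, enorm th = 1 -> `|g th| <= N) -> forall x, `|cutf kap g x| <= M * `|N|.
Proof.
move=> kM k0 gN x; rewrite normrM.
have M0 : 0 <= M by apply: le_trans (kM 0).
have [x0|x0] := eqVneq (enorm (vecn x)) 0.
  by rewrite x0 expr0n k0 normr0 mul0r mulr_ge0.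
have {}x0 : 0 < enorm (vecn x) by rewrite lt_neqAle eq_sym x0 enorm_ge0.
apply: ler_pM => //; apply: le_trans (gN _ (dir_norm x0)) _; exact: ler_norm.
Qed.

End SphereClass.

(** * A continuously differentiable radial cutoff *)

Section Cutoff.
Context {R : realType}.

(** A two-sided quadratic remainder treats the gluing point of [pos2] like any other point. *)
Lemma der_quadratic (f : R -> R) (t l C : R) :
  (forall h, `|f (t + h) - f t - l * h| <= C * h ^+ 2) -> is_derive t 1 f l.
Proof.
move=> hf; apply/is_derive_cvgP; apply/cvgrPdist_le => e e0.
have C0 : 0 <= C by have := le_trans (normr_ge0 _) (hf 1); rewrite expr1n mulr1.
have : \forall h \near (0 : R)^', `|h| <= e / (C + 1) /\ h != 0.
  have n1 : \forall h \near (0 : R)^', h != 0 by exact: nbhs_dnbhs_neq.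
  suff n2 : \forall h \near (0 : R)^', `|h| <= e / (C + 1) by exact: filterI n2 n1.
  apply: nbhs_dnbhs; have := @cvg_id R (nbhs (0 : R)).
  move=> /cvgr0Pnorm_le; apply; apply: divr_gt0 => //; lra.
apply: filterS => h [he h0].
rewrite distrC (_ : _ - l = h^-1 * (f (t + h) - f t - l * h)); last by field.
rewrite normrM normfV ler_pdivrMl ?normr_gt0 //.
apply: le_trans (hf h) _; rewrite -real_normK ?num_real // expr2.
rewrite mulrCA; apply: ler_wpM2l => //.
apply: (@le_trans _ _ (C * (e / (C + 1)))); first exact: ler_wpM2l.
rewrite mulrA ler_pdivrMr; last by lra.
by rewrite mulrC; apply: ler_wpM2l; [exact: ltW|lra].
Qed.

Definition pos2 (z : R) : R := Num.max z 0 ^+ 2.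

Lemma pos2_derive (z : R) : is_derive z 1 pos2 (2 * Num.max z 0).
Proof.
apply: (@der_quadratic _ _ _ 1) => h; rewrite mul1r /pos2.
have [z0|z0] := leP z 0; have [zh|zh] := leP (z + h) 0.
- by rewrite !expr0n /= mulr0 mul0r subrr subr0 normr0 sqr_ge0.
- rewrite expr0n /= mulr0 mul0r !subr0 ger0_norm ?sqr_ge0 //; nra.
- by rewrite ler_norml; apply/andP; split; nra.
- by rewrite ler_norml; apply/andP; split; nra.
Qed.

Definition eta (z : R) : R := pos2 z / (1 + pos2 z).
Definition eta' (z : R) : R := 2 * Num.max z 0 / (1 + pos2 z) ^+ 2.

Lemma pos2_ge0 z : 0 <= pos2 z. Proof. exact: sqr_ge0. Qed.

Lemma eta_derive (z : R) : is_derive z 1 eta (eta' z).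
Proof.
have h := pos2_derive z; have p0 := pos2_ge0 z.
have h1 := der_add (der_cst 1 z (1:R)) h.
have n0 : 1 + pos2 z != 0 by rewrite gt_eqF //; lra.
have h2 := @is_deriveV R (fun y => 1 + pos2 y) z _ 1 n0 h1.
apply: (is_derive_eq (der_mul h h2)).
by rewrite /eta' /GRing.scale /=; field.
Qed.

Lemma pos2_continuous : continuous pos2.
Proof. by move=> z; exact: is_derive_cont (pos2_derive z). Qed.

Lemma eta'_continuous : continuous eta'.
Proof.
move=> z; apply: cvgM.
  apply: cvgM; first exact: cvg_cst.
  by apply: continuous_max; [exact: cvg_id|exact: cvg_cst].
apply: cvgV; first by rewrite gt_eqF // exprn_gt0 //; have := pos2_ge0 z; lra.
have h : 1 + pos2 t @[t --> z] --> 1 + pos2 z.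
  by apply: cvgD; [exact: cvg_cst|exact: pos2_continuous].
exact: (cvg_comp _ _ h (@exprn_continuous R 2 _)).
Qed.

Lemma eta_itv z : 0 <= eta z <= 1.
Proof.
have p0 := pos2_ge0 z; rewrite /eta divr_ge0 //=; last by lra.
by rewrite ler_pdivrMr; lra.
Qed.

Lemma eta'_itv z : 0 <= eta' z <= 1.
Proof.
have p0 := pos2_ge0 z; rewrite /eta'; have m0 : 0 <= Num.max z 0 by rewrite le_max lexx orbT.
rewrite divr_ge0 ?exprn_ge0 //=; [|by rewrite mulr_ge0|by lra].
rewrite ler_pdivrMr ?exprn_gt0 //; last by lra.
by move: p0; rewrite /pos2; set w := Num.max z 0 in m0 *; nra.
Qed.

Lemma eta_npos z : z <= 0 -> eta z = 0 /\ eta' z = 0.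
Proof.
by move=> z0; rewrite /eta /eta' /pos2 (max_idPr z0) expr0n /= mulr0 !mul0r.
Qed.

Lemma eta_ge z : 0 < z -> 1 - eta z <= z ^- 2.
Proof.
move=> z0; rewrite /eta /pos2 (max_idPl (ltW z0)).
have z2 : 0 < z ^+ 2 by rewrite exprn_gt0.
rewrite (_ : 1 - _ = (1 + z ^+ 2)^-1); last by field; rewrite gt_eqF //; lra.
by rewrite lef_pV2 ?posrE //; lra.
Qed.

(** To be evaluated at the squared norm. The factor [s * (1 - s)] is positive exactly on the open
    unit interval, where [psi m] tends to 1; the shift by 1 makes [psi m] vanish on a whole
    neighbourhood of 0, away from which directions are continuous. *)
Definition psi (m : nat) (s : R) : R := eta (m%:R * (s * (1 - s)) - 1).
Definition psi' (m : nat) (s : R) : R :=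
  eta' (m%:R * (s * (1 - s)) - 1) * (m%:R * (1 - 2 * s)).

Lemma psi_derive m (s : R) : is_derive s 1 (psi m) (psi' m s).
Proof.
have h : is_derive s 1 (fun s : R => m%:R * (s * (1 - s)) - 1) (m%:R * (1 - 2 * s)).
  have h1 := der_add (der_cst 1 s (1:R)) (der_mul (der_cst (-1) s (1:R)) (is_derive_id s (1:R))).
  have h2 := der_mul (is_derive_id s (1:R)) h1.
  have h3 := der_add (der_mul (der_cst m%:R s (1:R)) h2) (der_cst (-1) s (1:R)).
  rewrite (_ : (fun s => _) = (fun x : R => m%:R * (id x * (1 + -1 * id x)) + -1)); last first.
    by apply/funext => x /=; rewrite mulN1r.
  by apply: (is_derive_eq h3) => /=; ring.
exact: (is_derive_eq (is_derive1_comp (eta_derive _) h)).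
Qed.

Lemma psi_continuous m : continuous (psi m).
Proof. by move=> s; exact: is_derive_cont (psi_derive m s). Qed.

Lemma psi'_continuous m : continuous (psi' m).
Proof.
move=> s.
have h : m%:R * (t * (1 - t)) - 1 @[t --> s] --> m%:R * (s * (1 - s)) - 1.
  apply: cvgB; last exact: cvg_cst.
  apply: cvgM; first exact: cvg_cst.
  by apply: cvgM; [exact: cvg_id|apply: cvgB; [exact: cvg_cst|exact: cvg_id]].
apply: cvgM; first exact: (cvg_comp _ _ h (@eta'_continuous _)).
apply: cvgM; first exact: cvg_cst.
apply: cvgB; first exact: cvg_cst.
by apply: cvgM; [exact: cvg_cst|exact: cvg_id].
Qed.

Lemma psi_zero m s : m%:R * (s * (1 - s)) <= 1 -> psi m s = 0 /\ psi' m s = 0.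
Proof.
move=> h; have [|e e'] := @eta_npos (m%:R * (s * (1 - s)) - 1); first by lra.
by rewrite /psi /psi' e e' mul0r.
Qed.

Lemma psi_small m s : s <= m.+1%:R^-1 -> psi m s = 0 /\ psi' m s = 0.
Proof.
move=> h; apply: psi_zero.
have h1 : s * (1 - s) <= s by nra.
have m0 : 0 <= m%:R :> R by [].
have : m%:R * (s * (1 - s)) <= m%:R * m.+1%:R^-1 by apply: ler_wpM2l => //; exact: le_trans h.
move=> /le_trans; apply; rewrite ler_pdivrMr ?ltr0n // mul1r ler_nat; exact: leqnSn.
Qed.

Lemma psi_large m s : 1 <= s -> psi m s = 0 /\ psi' m s = 0.
Proof.
move=> h; apply: psi_zero; have : s * (1 - s) <= 0 by nra.
by move=> h1; have : m%:R * (s * (1 - s)) <= 0; [apply: mulr_ge0_le0|lra].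
Qed.

Lemma psi_norm m s : `|psi m s| <= 1.
Proof. by have /andP[h0 h1] := eta_itv (m%:R * (s * (1 - s)) - 1); rewrite ger0_norm. Qed.

(** Growth in [m] is harmless: the bound serves one [m] at a time, and the terms with [psi'] cancel
    before the limit is taken. *)
Lemma psi_combo_bound m s : `|psi m s + 2 * s * psi' m s| <= 1 + 2 * m%:R.
Proof.
have m0 : 0 <= m%:R :> R by [].
have [s1|s1] := leP 1 s.
  by have [-> ->] := psi_large m s1; rewrite mulr0 addr0 normr0; lra.
have [s0|s0] := leP s 0.
  have [|-> ->] := @psi_small m s; first by apply: le_trans s0 _; rewrite invr_ge0.
  by rewrite mulr0 addr0 normr0; lra.
apply: le_trans (ler_normD _ _) _; apply: lerD; first exact: psi_norm.
rewrite /psi'; move: (eta'_itv (m%:R * (s * (1 - s)) - 1)).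
move: (eta' _) => E /andP[e0 e1].
rewrite !normrM [`|2|]ger0_norm // [`|s|]gtr0_norm // [`|m%:R|]ger0_norm // [`|E|]ger0_norm //.
have ha : `|1 - 2 * s| <= 1 by rewrite ler_norml; apply/andP; split; lra.
have h1 : E * (m%:R * `|1 - 2 * s|) <= 1 * (m%:R * 1).
  by apply: ler_pM => //; exact: ler_wpM2l.
have h2 : 0 <= E * (m%:R * `|1 - 2 * s|) by rewrite !mulr_ge0.
nra.
Qed.

Lemma psi_cvg s : psi m s @[m --> \oo] --> (if 0 < s < 1 then 1 else 0 : R).
Proof.
case: ifP => [/andP[s0 s1]|/negbT]; last first.
  rewrite negb_and -!leNgt => hs.
  have E m : psi m s = 0.
    case/orP: hs => hs; last by have [] := psi_large m hs.
    by have [] := @psi_small m s; first by apply: le_trans hs _; rewrite invr_ge0.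
  by rewrite (_ : psi^~ s = fun=> 0); [exact: cvg_cst|apply/funext].
have q0 : 0 < s * (1 - s) by rewrite mulr_gt0 // subr_gt0.
apply/cvgrPdist_le => e e0.
(* Chosen so that the argument [z] of [eta] is at least [1 + e^-1]; then
   [1 - eta z <= z ^- 2 <= e]. *)
pose A := ((1 + e^-1) + 1) / (s * (1 - s)).
have : \forall m \near \oo, A <= m%:R by exact: nbhs_infty_ger.
apply: filterS => m; rewrite ler_pdivrMr // => hm.
have ei : 0 < e^-1 by rewrite invr_gt0.
set z := m%:R * (s * (1 - s)) - 1.
have hz : 1 + e^-1 <= z by rewrite /z; lra.
have z0 : 0 < z by lra.
have := eta_ge z0; rewrite -/z => hh.
have /andP[e1 e2] := eta_itv z.
rewrite /psi -/z ger0_norm ?subr_ge0 //; apply: le_trans hh _.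
rewrite -[leRHS]invrK lef_pV2 ?posrE ?exprn_gt0 //.
by rewrite expr2; nra.
Qed.

End Cutoff.

(** * The sphere integral *)

Section UnitBall.
Context {R : realType}.

(** The integrand of the sphere integral on the punctured open ball, whose indicator is the
    pointwise limit of the cutoffs [psi m]. *)
Definition sph0 d (g : 'rV[R]_d -> R) (x : nat -> R) : R :=
  if 0 < enorm (vecn d x) < 1 then g (dir d x) else 0.

Lemma cube_unit_ball n (g : 'rV[R]_n.+1 -> R) : baire (sph0 g) ->
  cube_int n.+1 (fun x => let y := vecn n.+1 x in
    if enorm y <= 1 then g ((enorm y)^-1 *: y) else 0) = cube_int n.+1 (sph0 g).
Proof.
move=> bG.
pose rest (x : nat -> R) : R := \sum_(i < n) x (lift ord0 i) ^+ 2.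
(* A line in direction 0 meets the unit sphere in at most the two points given by the square root;
   excluding the value 0 removes the origin. *)
apply: (@cube_except _ _ _ _ (fun x => [:: 0; Num.sqrt (1 - rest x); - Num.sqrt (1 - rest x)])) => //.
move=> x t; rewrite !inE !negb_or => /and3P[t0 t1 t2] /=; rewrite /sph0.
set y := vecn _ _.
have yE : enorm y ^+ 2 = t ^+ 2 + rest x.
  rewrite enorm_sqr big_ord_recl mxE /upd /=; congr (_ + _).
  by apply: eq_bigr => i _; rewrite mxE /=.
have r0 : 0 <= rest x by apply: sumr_ge0 => i _; exact: sqr_ge0.
have tt : 0 < t ^+ 2 by rewrite lt_neqAle sqr_ge0 eq_sym sqrf_eq0 t0.
have y0 : 0 < enorm y.
  rewrite lt_neqAle enorm_ge0 andbT eq_sym -sqrf_eq0 yE gt_eqF //; lra.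
have y1 : enorm y != 1.
  apply/negP => /eqP y1; move: yE; rewrite y1 expr1n => e.
  have e2 : t ^+ 2 = (Num.sqrt (1 - rest x)) ^+ 2 by rewrite sqr_sqrtr; lra.
  by move/eqP: e2; rewrite eqf_sqr (negbTE t1) (negbTE t2).
by rewrite y0 /= le_eqVlt (negbTE y1).
Qed.

End UnitBall.

Section SphereIntegral.
Context {R : realType}.
Variable d : nat.
Hypothesis d0 : (0 < d)%N.
Implicit Types (g h u w : 'rV[R]_d -> R) (th : 'rV[R]_d) (x : nat -> R).

Lemma sqr_lt_1 (r : R) : 0 <= r -> (0 < r ^+ 2 < 1) = (0 < r < 1).
Proof.
move=> r0; rewrite lt0r sqrf_eq0 sqr_ge0 andbT [0 < r]lt0r r0 andbT.
by congr (_ && _); rewrite -{1}(expr1n _ 2) ltr_pXn2r ?nnegrE.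
Qed.

Lemma sph0_baire g : sphere_cont g -> baire (sph0 g).
Proof.
move=> cg; have [_ [M gM]] := cg.
apply: (@baire_lim _ (fun m => cutf (psi m) g) _ (1 * `|M|)).
- move=> m; apply: (@baire_cont _ _ (1 * `|M|)).
    apply: (@scont_cutf _ _ (psi m) m.+1%:R^-1) => //; first exact: psi_continuous.
    by move=> s hs; have [] := psi_small hs.
  apply: cutf_bound => //; first exact: psi_norm.
  by have [] := @psi_small R m 0.
- move=> m; apply: cutf_bound => //; first exact: psi_norm.
  by have [] := @psi_small R m 0.
- move=> x; rewrite /cutf (_ : sph0 g x = (if 0 < enorm (vecn d x) ^+ 2 < 1 then 1 else 0) * g (dir d x)).
    by apply: cvgM; [exact: psi_cvg|exact: cvg_cst].
  by rewrite /sph0 sqr_lt_1 ?enorm_ge0 //; case: ifP; rewrite ?mul1r ?mul0r.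
Qed.

Lemma sphere_intRE g : sphere_cont g -> sphere_intR g = d%:R * cube_int d (sph0 g).
Proof.
move=> cg; rewrite /sphere_intR; congr (_ * _).
have := sph0_baire cg; clear cg.
by case: d d0 g => // n _ g; exact: cube_unit_ball.
Qed.

Lemma sphere_lin g h a b : sphere_cont g -> sphere_cont h ->
  sphere_intR (fun th => a * g th + b * h th) = a * sphere_intR g + b * sphere_intR h.
Proof.
move=> cg ch; rewrite !sphere_intRE //; last exact: sphere_cont_lin.
rewrite (_ : sph0 _ = fun x => a * sph0 g x + b * sph0 h x).
  by rewrite cube_linear; [ring|exact: sph0_baire|exact: sph0_baire].
by apply/funext => x; rewrite /sph0; case: ifP => // _; rewrite !mulr0 addr0.
Qed.

Lemma sph0_le g h x : (forall th, enorm th = 1 -> g th <= h th) -> sph0 g x <= sph0 h x.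
Proof.
by move=> gh; rewrite /sph0; case: ifP => // /andP[x0 _]; apply: gh; exact: dir_norm.
Qed.

Lemma sphere_le g h : sphere_cont g -> sphere_cont h ->
  (forall th, enorm th = 1 -> g th <= h th) -> sphere_intR g <= sphere_intR h.
Proof.
move=> cg ch gh; rewrite !sphere_intRE //; apply: ler_wpM2l => //.
by apply: cube_le => [||x]; [exact: sph0_baire|exact: sph0_baire|exact: sph0_le].
Qed.

Lemma sphere_eq g h : sphere_cont g -> (forall th, enorm th = 1 -> g th = h th) ->
  sphere_intR g = sphere_intR h.
Proof.
move=> cg gh; have ch := sphere_cont_eq gh cg.
by apply/eqP; rewrite eq_le !sphere_le // => th th1; rewrite gh.
Qed.

Lemma sphere_dct (Fs : nat -> 'rV[R]_d -> R) g (M : R) :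
  (forall m, sphere_cont (Fs m)) -> sphere_cont g ->
  (forall m th, enorm th = 1 -> `|Fs m th| <= M) ->
  (forall th, enorm th = 1 -> Fs m th @[m --> \oo] --> g th) ->
  sphere_intR (Fs m) @[m --> \oo] --> sphere_intR g.
Proof.
move=> cF cg FM Fg; rewrite sphere_intRE //.
rewrite (_ : (fun m => _) = (fun m => d%:R * cube_int d (sph0 (Fs m)))); last first.
  by apply/funext => m; rewrite sphere_intRE.
apply: cvgM; first exact: cvg_cst.
apply: (@cube_cvg _ _ _ _ `|M|).
- by move=> m; exact: sph0_baire.
- move=> m x; rewrite /sph0; case: ifP => [/andP[x0 _]|_]; last by rewrite normr0.
  by apply: le_trans (ler_norm M); apply: FM; exact: dir_norm.
- move=> x; rewrite /sph0; case: ifP => [/andP[x0 _]|_]; last exact: cvg_cst.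
  by apply: Fg; exact: dir_norm.
Qed.

Lemma sphere_derive (K K' : R -> 'rV[R]_d -> R) (t0 e M : R) : 0 < e ->
  (forall t, `|t - t0| < e -> sphere_cont (K t)) -> sphere_cont (K' t0) ->
  (forall (t : R) th, `|t - t0| < e -> enorm th = 1 ->
     is_derive t (1 : R) (fun s => K s th) (K' t th) /\ `|K' t th| <= M) ->
  is_derive t0 1 (fun t => sphere_intR (K t)) (sphere_intR (K' t0)).
Proof.
move=> e0 cK cK' dK.
have H := @derive_under R 'rV[R]_d [set th | enorm th = 1] (@sphere_cont R d) (@sphere_intR R d) _ _ _ K K' t0 e M.
apply: H => //.
- by move=> F G a b; exact: sphere_cont_lin.
- by move=> F G a b; exact: sphere_lin.
- by move=> Fs F N cF cg FN Fg; exact: sphere_dct FN Fg.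
Qed.

(** The Euler operator, on the unit sphere the radial derivative. *)
Definition euler (dw : 'I_d -> 'rV[R]_d -> R) th := \sum_i th 0 i * dw i th.

Lemma upd_vecn x (j : 'I_d) (t : R) (i : 'I_d) :
  vecn d (upd x j t) 0 i = if i == j then t else x i.
Proof. by rewrite mxE /upd. Qed.

Lemma vecn_coord_derive x (j i : 'I_d) (t : R) :
  is_derive t (1 : R) (fun s => vecn d (upd x j s) 0 i) (i == j)%:R.
Proof.
rewrite (_ : (fun s => _) = (fun s : R => if i == j then s else x i)); last first.
  by apply/funext => s; exact: upd_vecn.
by case: (i == j); [exact: is_derive_id|exact: der_cst].
Qed.

Lemma enorm_sqr_derive x (j : 'I_d) (t : R) :
  is_derive t (1 : R) (fun s => enorm (vecn d (upd x j s)) ^+ 2) (2 * t).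
Proof.
rewrite (_ : (fun s => _) = (fun s => \sum_i vecn d (upd x j s) 0 i * vecn d (upd x j s) 0 i)).
  apply: (is_derive_eq (der_sum _ (fun i => der_mul (vecn_coord_derive x j i t) (vecn_coord_derive x j i t)))).
  rewrite (bigD1 j) //= big1 ?addr0 => [|i ij]; rewrite !upd_vecn ?eqxx.
    by rewrite mul1r mulr1; ring.
  by rewrite (negbTE ij) mul0r mulr0 addr0.
by apply/funext => s; rewrite enorm_sqr; apply: eq_bigr => i _; rewrite expr2.
Qed.

Lemma enorm_derive x (j : 'I_d) (t : R) : 0 < enorm (vecn d (upd x j t)) ->
  is_derive t (1 : R) (fun s => enorm (vecn d (upd x j s))) (t / enorm (vecn d (upd x j t))).
Proof.
move=> p0; have p2 : 0 < enorm (vecn d (upd x j t)) ^+ 2 by rewrite exprn_gt0.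
have h := @is_derive1_comp R _ (fun s => enorm (vecn d (upd x j s)) ^+ 2) t _ _ (is_derive1_sqrt p2) (enorm_sqr_derive x j t).
rewrite (_ : (fun s => _) = Num.sqrt \o (fun s => enorm (vecn d (upd x j s)) ^+ 2)).
  apply: (is_derive_eq h); rewrite sqrtr_sqr ger0_norm ?enorm_ge0 //.
  by field; rewrite gt_eqF.
by apply/funext => s /=; rewrite sqrtr_sqr ger0_norm ?enorm_ge0.
Qed.

Section Divergence.
Variable G : set 'rV[R]_d.
Hypothesis oG : open G.
Hypothesis SG : forall th, enorm th = 1 -> G th.

Lemma has_grad_sphere_cont u du : has_grad G u du ->
  sphere_cont u /\ forall i, sphere_cont (du i).
Proof.
move=> h; split; first by apply: sphere_cont_of => th /SG; exact: has_grad_continuous oG h.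
by move=> i; apply: sphere_cont_of => th /SG Gth; exact: (h th Gth i).2.
Qed.

Lemma euler_sphere_cont u du : has_grad G u du -> sphere_cont (euler du).
Proof.
move=> h; apply: sphere_cont_sum => i; apply: sphere_cont_mul; first exact: sphere_cont_coord.
exact: (has_grad_sphere_cont h).2.
Qed.

(* Radial cutoff of the degree-one homogeneous extension of [w]. *)
Definition rad m w := cutf (fun s => Num.sqrt s * psi m s) w.
Definition drad m w dw (j : 'I_d) x :=
  cutf (fun s => psi m s + 2 * s * psi' m s) (fun th => th 0 j * w th) x +
  cutf (psi m) (fun th => dw j th + - th 0 j * euler dw th) x.

(** Differentiating the direction produces a factor 1/|x|, which homogeneity of degree one absorbs.
    Hence the derivative is again a sum of two terms [cutf]: a normal part, with the derivative of
    the cutoff, and the tangential gradient. *)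
Lemma rad_derive m w dw (j : 'I_d) x (t : R) : has_grad G w dw ->
  is_derive t (1 : R) (fun s => rad m w (upd x j s)) (drad m w dw j (upd x j t)).
Proof.
move=> hw; pose N s := enorm (vecn d (upd x j s)).
have N2c := is_derive_cont (enorm_sqr_derive x j t).
(* At the origin the norm is not differentiable, but the cutoff vanishes nearby. *)
have [N0|N0] := eqVneq (N t) 0.
  have m0 : 0 < m.+1%:R^-1 :> R by rewrite invr_gt0 ltr0n.
  rewrite /drad /cutf -/(N t) N0 expr0n /=.
  have [-> ->] : psi m 0 = 0 :> R /\ psi' m 0 = 0 :> R by apply: psi_small; exact: ltW.
  rewrite !(mulr0, mul0r, addr0).
  apply: (@is_derive_near _ (fun=> 0)).
  have : \forall s \near t, N s ^+ 2 <= m.+1%:R^-1.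
    by apply: (cvgr_le _ N2c); rewrite -/(N t) N0 expr0n.
  by apply: filterS => s hs; rewrite /rad /cutf (psi_small hs).1 mulr0 mul0r.
have {}N0 : 0 < N t by rewrite lt_neqAle eq_sym N0 enorm_ge0.
have nN0 : N t != 0 by rewrite gt_eqF.
have dN : is_derive t (1 : R) N (t / N t) by exact: enorm_derive.
have dpsi := @is_derive1_comp R _ (fun s => N s ^+ 2) t _ _ (psi_derive m (N t ^+ 2)) (enorm_sqr_derive x j t).
have dinv := @is_deriveV R N t _ 1 nN0 dN.
pose c s := dir d (upd x j s).
have dc i : is_derive t (1 : R) (fun s => c s 0 i)
   ((- N t ^- 2 * (t / N t)) * vecn d (upd x j t) 0 i + (N t)^-1 * (i == j)%:R).
  rewrite (_ : (fun s => _) = (fun s => (N s)^-1 * vecn d (upd x j s) 0 i)); last first.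
    by apply/funext => s; rewrite /c /dir !mxE.
  exact: (der_mul dinv (vecn_coord_derive x j i t)).
have Gc : G (c t) by apply: SG; exact: dir_norm.
have dw' := chain_rule oG hw Gc dc.
rewrite (_ : (fun s => _) = (fun s => (N s * psi m (N s ^+ 2)) * w (c s))); last first.
  by apply/funext => s; rewrite /rad /cutf sqrtr_sqr ger0_norm ?enorm_ge0.
apply: (is_derive_eq (der_mul (der_mul dN dpsi) dw')) => /=.
have ci k : vecn d (upd x j t) 0 k = N t * c t 0 k.
  by rewrite /c /dir [in RHS]mxE mulrA mulfV // mul1r.
have cj : t / N t = c t 0 j.
  by rewrite /c /dir [in RHS]mxE upd_vecn eqxx mulrC.
have t2 : 2 * t = 2 * (N t * c t 0 j) by rewrite -ci upd_vecn eqxx.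
rewrite cj t2.
have -> : \sum_i dw i (c t) * (- N t ^- 2 * c t 0 j * vecn d (upd x j t) 0 i + (N t)^-1 * (i == j)%:R)
   = (N t)^-1 * (dw j (c t) - c t 0 j * euler dw (c t)).
  rewrite mulrBr -{1}[(N t)^-1 * dw j _]addr0 /euler.
  under eq_bigr do rewrite mulrDr.
  rewrite big_split /= addrC; congr (_ + _).
    rewrite (bigD1 j) //= eqxx mulr1 big1 ?addr0 1?mulrC // => i ij.
    by rewrite (negbTE ij) !mulr0.
  rewrite [in RHS]mulrA [in RHS]mulr_sumr -sumrN; apply: eq_bigr => i _.
  by rewrite ci; field.
rewrite /drad /cutf -/(N t) -/(c t).
by field.
Qed.

Lemma rad_zero_outside m w (j : 'I_d) x : `|x j| = 1 -> rad m w x = 0.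
Proof.
move=> xj; rewrite /rad /cutf.
have h : 1 <= enorm (vecn d x).
  by rewrite -xj; have := coord_le_enorm (vecn d x) j; rewrite mxE.
have h2 : 1 <= enorm (vecn d x) ^+ 2 by exact: exprn_ege1.
by rewrite (psi_large m h2).1 mulr0 mul0r.
Qed.

Lemma rad_bound m s : `|Num.sqrt s * psi m s| <= 1 :> R.
Proof.
have [s1|s1] := leP 1 s; first by rewrite (psi_large m s1).1 mulr0 normr0.
rewrite normrM -[leRHS]mulr1; apply: ler_pM => //; last exact: psi_norm.
by rewrite ger0_norm ?sqrtr_ge0 // -[leRHS]sqrtr1 ler_wsqrtr // ltW.
Qed.

Lemma cube_drad m w dw (j : 'I_d) : has_grad G w dw ->
  scont (drad m w dw j) /\ cube_int d (drad m w dw j) = 0.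
Proof.
move=> hw; have [cw cdw] := has_grad_sphere_cont hw.
have m0 : 0 < m.+1%:R^-1 :> R by rewrite invr_gt0 ltr0n.
have c1 : sphere_cont (fun th => th 0 j * w th).
  by apply: sphere_cont_mul => //; exact: sphere_cont_coord.
have c2 : sphere_cont (fun th => dw j th + - th 0 j * euler dw th).
  apply: (@sphere_cont_eq _ _ (fun th => 1 * dw j th + (-1) * (th 0 j * euler dw th))).
    by move=> th _; ring.
  apply: sphere_cont_lin => //; apply: sphere_cont_mul; first exact: sphere_cont_coord.
  exact: euler_sphere_cont hw.
have s1 : scont (cutf (fun s => psi m s + 2 * s * psi' m s) (fun th => th 0 j * w th)).
  apply: (scont_cutf m0) => //.
    move=> s; apply: cvgD; first exact: psi_continuous.
    apply: cvgM; last exact: psi'_continuous.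
    by apply: cvgM; [exact: cvg_cst|exact: cvg_id].
  by move=> s /psi_small[-> ->]; rewrite mulr0 addr0.
have s2 : scont (cutf (psi m) (fun th => dw j th + - th 0 j * euler dw th)).
  apply: (scont_cutf m0) => //; first exact: psi_continuous.
  by move=> s /psi_small[-> _].
have sd : scont (drad m w dw j) by move=> xs x h; apply: cvgD; [exact: s1|exact: s2].
split => //.
have [_ [M1 b1]] := c1; have [_ [M2 b2]] := c2; have [_ [M3 b3]] := cw.
have p0 : psi m 0 = 0 :> R /\ psi' m 0 = 0 :> R by apply: psi_small; exact: ltW.
have [p00 p00'] := p0.
apply: (@cube_int_derive _ _ j (rad m w) _ (1 * `|M3| + ((1 + 2 * m%:R) * `|M1| + 1 * `|M2|))) => //.
- apply: (scont_cutf m0) => //.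
    by move=> s; apply: cvgM; [exact: sqrt_continuous|exact: psi_continuous].
  by move=> s /psi_small[-> _]; rewrite mulr0.
- move=> x; apply: (@le_trans _ _ (1 * `|M3|)).
    by apply: cutf_bound => //; [exact: rad_bound|rewrite p00 mulr0].
  by rewrite lerDl addr_ge0 // mulr_ge0 //; have : 0 <= m%:R :> R by []; lra.
- move=> x; apply: (@le_trans _ _ ((1 + 2 * m%:R) * `|M1| + 1 * `|M2|)); last first.
    by rewrite lerDr mulr_ge0.
  apply: le_trans (ler_normD _ _) _; apply: lerD.
    by apply: cutf_bound => //; [exact: psi_combo_bound|rewrite p00 p00' mulr0 addr0].
  by apply: cutf_bound => //; exact: psi_norm.
- by move=> x t; exact: rad_derive.
- by move=> x; exact: rad_zero_outside.
Qed.

(* Divergence theorem on the sphere for a tangential field: the terms of [drad] in which the cutoff is differentiated cancel. *)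
Lemma sphere_divergence (w : 'I_d -> 'rV[R]_d -> R) dw :
  (forall j, has_grad G (w j) (dw j)) ->
  (forall th, enorm th = 1 -> \sum_j th 0 j * w j th = 0) ->
  sphere_intR (fun th => \sum_j (dw j j th + - th 0 j * euler (dw j) th)) = 0.
Proof.
move=> hw tw; set D := (fun th => _).
have cj j : sphere_cont (fun th => dw j j th + - th 0 j * euler (dw j) th).
  apply: (@sphere_cont_eq _ _ (fun th => 1 * dw j j th + (-1) * (th 0 j * euler (dw j) th))).
    by move=> th _; ring.
  apply: sphere_cont_lin; first exact: (has_grad_sphere_cont (hw j)).2.
  apply: sphere_cont_mul; first exact: sphere_cont_coord.
  exact: euler_sphere_cont (hw j).
have cD : sphere_cont D by apply: sphere_cont_sum.
rewrite sphere_intRE //; apply/eqP; rewrite mulf_eq0; apply/orP; right; apply/eqP.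
have [_ [M DM]] := cD.
have m0 m : 0 < m.+1%:R^-1 :> R by rewrite invr_gt0 ltr0n.
have sc m : scont (cutf (psi m) D).
  apply: (scont_cutf (m0 m)) => //; first exact: psi_continuous.
  by move=> s /psi_small[-> _].
have bd m x : `|cutf (psi m) D x| <= 1 * `|M|.
  apply: cutf_bound => //; first exact: psi_norm.
  by have [] := @psi_small R m 0 (ltW (m0 m)).
have Z m : cube_int d (cutf (psi m) D) = 0.
  have -> : cutf (psi m) D = fun x => \sum_j drad m (w j) (dw j) j x.
    apply/funext => x; rewrite /drad big_split /=.
    have -> : \sum_j cutf (fun s => psi m s + 2 * s * psi' m s) (fun th => th 0 j * w j th) x = 0.
      rewrite /cutf -mulr_sumr.
      (* Tangency says nothing at the origin, where [dir x] is zero; there the cutoff factor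
         vanishes. *)
      have [x0|x0] := eqVneq (enorm (vecn d x)) 0.
        rewrite x0 expr0n /=; have [-> ->] := @psi_small R m 0 (ltW (m0 m)).
        by rewrite mulr0 addr0 mul0r.
      by rewrite tw ?mulr0 // dir_norm // lt_neqAle eq_sym x0 enorm_ge0.
    by rewrite add0r /cutf mulr_sumr.
  have bj j : baire (drad m (w j) (dw j) j).
    have [s _] := cube_drad m j (hw j).
    have [_ [M1 b1]] := (sphere_cont_mul (sphere_cont_coord j) (has_grad_sphere_cont (hw j)).1).
    have [_ [M2 b2]] := cj j.
    apply: (@baire_cont _ _ ((1 + 2 * m%:R) * `|M1| + 1 * `|M2|)) => // x.
    have [p p'] := @psi_small R m 0 (ltW (m0 m)).
    apply: le_trans (ler_normD _ _) _; apply: lerD.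
      by apply: cutf_bound => //; [exact: psi_combo_bound|rewrite p p' mulr0 addr0].
    by apply: cutf_bound => //; exact: psi_norm.
  suff H : forall s : seq 'I_d, baire (fun x => \sum_(j <- s) drad m (w j) (dw j) j x) /\
     cube_int d (fun x => \sum_(j <- s) drad m (w j) (dw j) j x) = 0.
    exact: (H (index_enum _)).2.
  elim=> [|j s [bs IH]].
    rewrite (_ : (fun=> _) = fun=> 0); last by apply/funext => x; rewrite big_nil.
    split; last exact: cube_int0.
    by apply: (@baire_cont _ _ 0) => [xs x _|x]; [exact: cvg_cst|rewrite normr0].
  rewrite (_ : (fun x => _) = (fun x => 1 * drad m (w j) (dw j) j x +
      1 * \sum_(j <- s) drad m (w j) (dw j) j x)); last first.
    by apply/funext => x; rewrite big_cons !mul1r.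
  split; first exact: baire_lin.
  by rewrite cube_linear // IH (cube_drad m j (hw j)).2 !mulr0 addr0.
have L : cube_int d (cutf (psi m) D) @[m --> \oo] --> cube_int d (sph0 D).
  apply: (@cube_cvg _ _ _ _ (1 * `|M|)) => //.
  - by move=> m; exact: baire_cont (bd m).
  - move=> x; rewrite /cutf (_ : sph0 D x = (if 0 < enorm (vecn d x) ^+ 2 < 1 then 1 else 0) * D (dir d x)).
      by apply: cvgM; [exact: psi_cvg|exact: cvg_cst].
    by rewrite /sph0 sqr_lt_1 ?enorm_ge0 //; case: ifP; rewrite ?mul1r ?mul0r.
rewrite -(cvg_lim _ L) //; apply: cvg_lim => //.
rewrite (_ : (fun m => _) = fun=> 0); first exact: cvg_cst.
by apply/funext => m; exact: Z.
Qed.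

End Divergence.
End SphereIntegral.

(** * Green's formula and the radial equation *)

Section Green.
Context {R : realType}.
Variable d : nat.
Hypothesis d0 : (0 < d)%N.
Implicit Types (g P u : 'rV[R]_d -> R) (th x : 'rV[R]_d) (G : set 'rV[R]_d).

(** The Hessian applied to the pair (x, x), on the unit sphere the second radial derivative. *)
Definition quad (dd : 'I_d -> 'I_d -> 'rV[R]_d -> R) x :=
  \sum_j \sum_i x 0 j * x 0 i * dd j i x.

Definition deuler (dg : 'I_d -> 'rV[R]_d -> R) (ddg : 'I_d -> 'I_d -> 'rV[R]_d -> R)
  (i : 'I_d) x := dg i x + \sum_k x 0 k * ddg k i x.

Lemma sum_delta (i : 'I_d) (f : 'I_d -> R) : \sum_k (i == k)%:R * f k = f i.
Proof.
rewrite (bigD1 i) //= eqxx mul1r big1 ?addr0 // => k ki.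
by rewrite eq_sym (negbTE ki) mul0r.
Qed.

Lemma mul_sum (c : R) (f : 'I_d -> R) : c * (\sum_i f i) = \sum_i c * f i.
Proof. exact: mulr_sumr. Qed.

Lemma enorm1_sum th : enorm th = 1 -> \sum_i th 0 i * th 0 i = 1.
Proof.
by move=> h; rewrite -[RHS](expr1n _ 2) -h enorm_sqr; apply: eq_bigr => i _; rewrite expr2.
Qed.

Lemma has_grad_euler G dg ddg : open G -> (forall i, has_grad G (dg i) (ddg i)) ->
  has_grad G (euler dg) (deuler dg ddg).
Proof.
move=> oG h.
have := hg_sum (index_enum 'I_d) (fun k => hg_mul oG (@hg_coord R d G k) (h k)).
apply: hg_ext => // x i _; rewrite big_split /= /deuler; congr (_ + _).
exact: sum_delta.
Qed.

Lemma euler_deuler dg ddg x : euler (deuler dg ddg) x = euler dg x + quad ddg x.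
Proof.
rewrite /euler /deuler /quad.
under eq_bigr do rewrite mulrDr mulr_sumr.
rewrite big_split /=; congr (_ + _); rewrite exchange_big /=.
by apply: eq_bigr => j _; apply: eq_bigr => i _; rewrite mulrCA mulrA.
Qed.

(** The divergence theorem for a general field, obtained from its tangential part: [w] is [u] minus
    the normal component [x * q], and [(d - 1) q] is the mean curvature term. *)
Lemma sphere_green G (u : 'I_d -> 'rV[R]_d -> R) du : open G ->
  (forall th, enorm th = 1 -> G th) -> (forall j, has_grad G (u j) (du j)) ->
  sphere_intR (fun th => \sum_j du j j th + - quad du th +
    - (d%:R - 1) * \sum_j th 0 j * u j th) = 0.
Proof.
move=> oG SG hu.
pose q x := \sum_i x 0 i * u i x.
pose dq i x := \sum_k ((i == k)%:R * u k x + x 0 k * du k i x).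
have hq : has_grad G q dq by apply: hg_sum => k; apply: hg_mul => //; exact: hg_coord.
pose w j x := u j x + -1 * (x 0 j * q x).
pose dw j i x := du j i x + (0 * (x 0 j * q x) + -1 * ((i == j)%:R * q x + x 0 j * dq i x)).
have hw j : has_grad G (w j) (dw j).
  apply: hg_add => //; apply: hg_mul => //; first exact: hg_cst.
  by apply: hg_mul => //; exact: hg_coord.
rewrite -[RHS](sphere_divergence d0 oG SG hw); last first.
  move=> th th1; rewrite /w.
  under eq_bigr do rewrite mulrDr mulN1r mulrN mulrA.
  by rewrite big_split /= sumrN -mulr_suml enorm1_sum // mul1r subrr.
symmetry; apply: sphere_eq => //.
  apply: sphere_cont_sum => j.
  apply: (@sphere_cont_eq _ _ (fun th => 1 * dw j j th + (-1) * (th 0 j * euler (dw j) th))).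
    by move=> th _; ring.
  apply: sphere_cont_lin; first exact: (has_grad_sphere_cont oG SG (hw j)).2.
  apply: sphere_cont_mul; first exact: sphere_cont_coord.
  exact: (euler_sphere_cont oG SG (hw j)).
move=> th th1.
(* The radial derivative [euler dq] enters [e1] and [e2] alike and cancels; the copies of [q] number
   [d] and 1, which leaves [d - 1]. *)
have e1 : \sum_j dw j j th = \sum_j du j j th - (d%:R * q th + euler dq th).
  rewrite /dw /euler big_split /=; congr (_ + _).
  rewrite -[d in d%:R]card_ord -sum1_card natr_sum mulr_suml -big_split -sumrN /=.
  by apply: eq_bigr => j _; rewrite eqxx /= mulr1n; ring.
have e2 : \sum_j th 0 j * euler (dw j) th = quad du th - (q th + euler dq th).
  have e3 j : euler (dw j) th = euler (du j) th - (th 0 j * q th + th 0 j * euler dq th).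
    rewrite /euler /dw; under eq_bigr do rewrite mulrDr.
    rewrite big_split /=; congr (_ + _).
    rewrite -[th 0 j * q th](@sum_delta j (fun i => th 0 i * q th)).
    rewrite [th 0 j * \sum_(i < d) th 0 i * dq i th]mulr_sumr -big_split -sumrN /=.
    by apply: eq_bigr => i _; rewrite eq_sym; ring.
  under eq_bigr do rewrite e3 mulrBr mulrDr !mulrA.
  rewrite sumrB big_split /= -!mulr_suml enorm1_sum // !mul1r; congr (_ - _).
  rewrite /quad /euler; apply: eq_bigr => j _; rewrite mulr_sumr.
  by apply: eq_bigr => i _; rewrite mulrA.
rewrite (eq_bigr (fun j => dw j j th - th 0 j * euler (dw j) th)); last by move=> j _; ring.
by rewrite sumrB e1 e2 -/(q th); ring.
Qed.

Lemma sphere_cont_quad (dd : 'I_d -> 'I_d -> 'rV[R]_d -> R) :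
  (forall i j, sphere_cont (dd i j)) -> sphere_cont (quad dd).
Proof.
move=> h; apply: sphere_cont_sum => j; apply: sphere_cont_sum => i.
by do 2?[apply: sphere_cont_mul => //]; exact: sphere_cont_coord.
Qed.

(** Green's second identity for the field P grad g - g grad P. The mixed products of radial
    derivatives cancel, and [k (k - 1) + (d - 1) k = k (k + d - 2)] gives the eigenvalue. *)
Lemma sphere_laplacian G g dg ddg P dP ddP (k : R) : open G ->
  (forall th, enorm th = 1 -> G th) ->
  has_grad G g dg -> (forall i, has_grad G (dg i) (ddg i)) ->
  has_grad G P dP -> (forall i, has_grad G (dP i) (ddP i)) ->
  (forall th, enorm th = 1 -> \sum_j ddP j j th = 0) ->
  (forall th, enorm th = 1 -> euler dP th = k * P th) ->
  (forall th, enorm th = 1 -> quad ddP th = k * (k - 1) * P th) ->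
  (forall i j, sphere_cont (ddg i j)) ->
  sphere_intR (fun th => (\sum_j ddg j j th) * P th) =
  sphere_intR (fun th => (quad ddg th + (d%:R - 1) * euler dg th
     - k * (k + d%:R - 2) * g th) * P th).
Proof.
move=> oG SG hg hdg hP hdP PL PE PQ cdd.
pose u j x := P x * dg j x + -1 * (g x * dP j x).
pose du j i x := (dP i x * dg j x + P x * ddg j i x) +
   (0 * (g x * dP j x) + -1 * (dg i x * dP j x + g x * ddP j i x)).
have hu j : has_grad G (u j) (du j).
  apply: hg_add; first exact: hg_mul.
  by apply: hg_mul => //; [exact: hg_cst|exact: hg_mul].
have [cg cdg] := has_grad_sphere_cont oG SG hg.
have [cP _] := has_grad_sphere_cont oG SG hP.
have cL : sphere_cont (fun th => (\sum_j ddg j j th) * P th).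
  by apply: sphere_cont_mul => //; apply: sphere_cont_sum.
have cR : sphere_cont (fun th => (quad ddg th + (d%:R - 1) * euler dg th
     - k * (k + d%:R - 2) * g th) * P th).
  apply: sphere_cont_mul => //.
  apply: (@sphere_cont_eq _ _ (fun th => 1 * quad ddg th + (1 * ((d%:R - 1) * euler dg th) +
     (- (k * (k + d%:R - 2))) * g th))); first by move=> th _; ring.
  apply: sphere_cont_add.
    by apply: sphere_cont_mul; [exact: sphere_cont_cst|exact: sphere_cont_quad].
  apply: sphere_cont_lin => //.
  by apply: sphere_cont_mul; [exact: sphere_cont_cst|exact: (euler_sphere_cont oG SG hg)].
apply/eqP; rewrite -subr_eq0 -[X in X == _](_ : sphere_intR (fun th =>
  1 * ((\sum_j ddg j j th) * P th) + -1 * ((quad ddg th + (d%:R - 1) * euler dg th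
     - k * (k + d%:R - 2) * g th) * P th)) = _); last first.
  by rewrite sphere_lin // mul1r mulN1r.
apply/eqP; rewrite -[RHS](sphere_green oG SG hu); apply: sphere_eq => //.
  exact: sphere_cont_lin.
move=> th th1.
have e1 : \sum_j du j j th = P th * \sum_j ddg j j th.
  have -> : P th * \sum_j ddg j j th = P th * \sum_j ddg j j th - g th * \sum_j ddP j j th.
    by rewrite PL // mulr0 subr0.
  rewrite (mul_sum (P th)) (mul_sum (g th)) -sumrB.
  by apply: eq_bigr => j _; rewrite /du; ring.
have e2 : quad du th = P th * quad ddg th - g th * quad ddP th.
  have e3 : quad du th = (euler dP th * euler dg th + P th * quad ddg th) -
      (euler dg th * euler dP th + g th * quad ddP th).
    have prodE (a b : 'I_d -> R) : (\sum_i a i) * (\sum_j b j) = \sum_j \sum_i (a i * b j).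
      by rewrite mulr_suml exchange_big /=; apply: eq_bigr => j _; rewrite mulr_sumr.
    rewrite /euler !prodE /quad (mul_sum (P th)) (mul_sum (g th)) -!big_split -sumrB /=.
    apply: eq_bigr => j _.
    rewrite (mul_sum (P th)) (mul_sum (g th)) -!big_split -sumrB /=.
    by apply: eq_bigr => i _; rewrite /du; ring.
  by rewrite e3; ring.
have e3 : \sum_j th 0 j * u j th = P th * euler dg th - g th * euler dP th.
  rewrite /u /euler !mulr_sumr -sumrB; apply: eq_bigr => j _; ring.
rewrite e1 e2 e3 PE // PQ //; ring.
Qed.

End Green.

Section HarmonicPolynomials.
Context {R : realType}.
Variable d : nat.
Implicit Types (P : 'rV[R]_d -> R) (x th : 'rV[R]_d).

(** The properties of a real harmonic polynomial used in the estimates; they pass to real parts,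
    imaginary parts and sign changes. *)
Definition harmonic_hom (k : nat) P :=
  [/\ forall n, Cn n setT P, forall x, lapR P x = 0 &
      forall (t : R) x, P (t *: x) = t ^+ k * P x].

(** Euler's identity: both sides are the derivative of P(s x) at s = 1. *)
Lemma euler_hom k P dP x : harmonic_hom k P -> has_grad setT P dP ->
  euler dP x = k%:R * P x.
Proof.
move=> [_ _ hP] gP.
have dc i : is_derive (1 : R) (1 : R) (fun s : R => (s *: x) 0 i) (x 0 i).
  rewrite (_ : (fun s => _) = (fun s : R => id s * x 0 i)); last first.
    by apply/funext => s; rewrite mxE.
  apply: (is_derive_eq (der_mul (is_derive_id _ _) (der_cst _ _ _))).
  by rewrite mulr0 addr0 mul1r.
have h1 := chain_rule (c := fun s => s *: x) openT gP (I : setT (1 *: x)) dc.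
have h2 : is_derive (1 : R) (1 : R) (fun s : R => P (s *: x)) (k%:R * P x).
  rewrite (_ : (fun s => _) = (fun s : R => s ^+ k * P x)); last first.
    by apply/funext => s; rewrite hP.
  have hX : is_derive (1 : R) (1 : R) (fun s : R => s ^+ k) k%:R.
    elim: (k) => [|j IH].
      rewrite (_ : (fun s => _) = fun=> 1); first exact: der_cst.
      by apply/funext => s; rewrite expr0.
    rewrite (_ : (fun s => _) = (fun s : R => id s * s ^+ j)); last first.
      by apply/funext => s; rewrite exprS.
    apply: (is_derive_eq (der_mul (is_derive_id _ _) IH)).
    by rewrite expr1n !mul1r -natr1 addrC.
  by apply: (is_derive_eq (der_mul hX (der_cst _ _ _))); rewrite mulr0 addr0.
have := der_unique h1 h2; rewrite scale1r => <-.
by apply: eq_bigr => i _; rewrite mulrC.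
Qed.

(** Euler's identity applied twice: x . grad(x . grad P) is [k ^ 2 P], and it exceeds the Hessian
    term by x . grad P = k P. *)
Lemma quad_hom k P dP ddP x : harmonic_hom k P -> has_grad setT P dP ->
  (forall i, has_grad setT (dP i) (ddP i)) ->
  quad ddP x = k%:R * (k%:R - 1) * P x.
Proof.
move=> hP gP gdP.
have h1 := has_grad_euler openT gdP.
have h2 : has_grad setT (euler dP) (fun i x => k%:R * dP i x).
  have := hg_mul openT (@hg_cst R d setT k%:R) gP.
  apply: hg_ext; first exact: openT.
    by move=> y _; rewrite (euler_hom y hP gP).
  by move=> y i _; rewrite mul0r add0r.
have e i : deuler dP ddP i x = k%:R * dP i x.
  exact: der_unique (h1 x I i).1 (h2 x I i).1.
have : euler (deuler dP ddP) x = k%:R * euler dP x.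
  by rewrite /euler mul_sum; apply: eq_bigr => i _; rewrite e; ring.
rewrite euler_deuler !(euler_hom x hP gP) => h.
have -> : quad ddP x = (k%:R * P x + quad ddP x) - k%:R * P x by ring.
by rewrite h; ring.
Qed.

(** Monomials are real on real vectors, so taking real or imaginary parts acts on the coefficients
    alone. *)
Lemma harm_hom_poly_parts k (Y : 'rV[R]_d -> R[i]) : harm_hom_poly k Y ->
  harmonic_hom k (ReF Y) /\ harmonic_hom k (ImF Y).
Proof.
move=> [[c hc] hL].
pose mono (al : {ffun 'I_d -> 'I_k.+1}) (x : 'rV[R]_d) : R := \prod_(i < d) x 0 i ^+ al i.
have monoE (al : {ffun 'I_d -> 'I_k.+1}) x :
    \prod_(i < d) ((x 0 i)%:C%C ^+ al i) = (mono al x)%:C%C.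
  by rewrite rmorph_prod; apply: eq_bigr => i _; rewrite rmorphXn.
have ReE x : ReF Y x = \sum_(al : {ffun 'I_d -> 'I_k.+1} | (\sum_(i < d) (al i : nat))%N == k)
    complex.Re (c al) * mono al x.
  rewrite /ReF hc raddf_sum; apply: eq_bigr => al _; rewrite monoE.
  by case: (c al) => a b /=; rewrite mulr0 subr0.
have ImE x : ImF Y x = \sum_(al : {ffun 'I_d -> 'I_k.+1} | (\sum_(i < d) (al i : nat))%N == k)
    complex.Im (c al) * mono al x.
  rewrite /ImF hc raddf_sum; apply: eq_bigr => al _; rewrite monoE.
  by case: (c al) => a b /=; rewrite mulr0 add0r.
have smooth (co : {ffun 'I_d -> 'I_k.+1} -> R) n : Cn n setT (fun x => \sum_(al : {ffun 'I_d -> 'I_k.+1} | (\sum_(i < d) (al i : nat))%N == k)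
    co al * mono al x).
  (* The degree condition moves into a filtered list, since [Cn_sum] treats unconditional sums over
     a list. *)
  rewrite (_ : (fun x => _) = (fun x => \sum_(al <- [seq al : {ffun 'I_d -> 'I_k.+1} <- index_enum _ | (\sum_(i < d) (al i : nat))%N == k])
    co al * mono al x)); last by apply/funext => x; rewrite big_filter.
  apply: Cn_sum => al; apply: Cn_mul; [exact: openT|exact: Cn_cst|].
  apply: Cn_prod; first exact: openT.
  by move=> i; apply: Cn_exp; [exact: openT|exact: Cn_coord].
have hom (co : {ffun 'I_d -> 'I_k.+1} -> R) (t : R) x :
   \sum_(al : {ffun 'I_d -> 'I_k.+1} | (\sum_(i < d) (al i : nat))%N == k) co al * mono al (t *: x)
   = t ^+ k * \sum_(al : {ffun 'I_d -> 'I_k.+1} | (\sum_(i < d) (al i : nat))%N == k) co al * mono al x.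
  rewrite mulr_sumr; apply: eq_bigr => al /eqP kE.
  have -> : t ^+ k = \prod_(i < d) t ^+ al i by rewrite -expr_sum kE.
  rewrite mulrCA; congr (_ * _); rewrite /mono -big_split /=.
  by apply: eq_bigr => i _; rewrite mxE exprMn.
split; split.
- by move=> n; have -> := funext ReE; exact: (smooth (fun al => complex.Re (c al))).
- by move=> x; have := hL x; rewrite /lapC => -[].
- by move=> t x; rewrite !ReE hom.
- by move=> n; have -> := funext ImE; exact: (smooth (fun al => complex.Im (c al))).
- by move=> x; have := hL x; rewrite /lapC => -[].
- by move=> t x; rewrite !ImE hom.
Qed.

End HarmonicPolynomials.

Section Coefficients.
Context {R : realType}.
Variable d : nat.
Hypothesis d0 : (0 < d)%N.
Implicit Types (g P u : 'rV[R]_d -> R) (th x : 'rV[R]_d) (G : set 'rV[R]_d).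

Lemma has_grad_sub G H u du : H `<=` G -> has_grad G u du -> has_grad H u du.
Proof. by move=> HG h x /HG; exact: h. Qed.

Lemma scale_continuous (r : R) : continuous (fun x : 'rV[R]_d => r *: x).
Proof. exact: scaler_continuous. Qed.

Lemma hg_scale G u du (r : R) : open G -> has_grad G u du ->
  has_grad [set x | G (r *: x)] (fun x => u (r *: x)) (fun i x => r * du i (r *: x)).
Proof.
move=> oG h x /= Gx i; split.
  apply/is_derive_line.
  have dc k : is_derive (0 : R) (1 : R) (fun s : R => (r *: (s *: evec i + x)) 0 k) (r * (k == i)%:R).
    rewrite (_ : (fun s => _) = (fun s : R => r * (x 0 k + (k == i)%:R * id s))).
      apply: (is_derive_eq (der_mul (der_cst r _ _) (der_add (der_cst _ _ _)
        (der_mul (der_cst _ _ _) (is_derive_id _ _))))).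
      by ring.
    apply/funext => s; rewrite mxE line_coord.
    by case: eqP => _; rewrite ?mul1r ?mul0r.
  have G0 : G (r *: (0 *: evec i + x)) by rewrite scale0r add0r.
  have := chain_rule (c := fun s : R => r *: (s *: evec i + x)) oG h G0 dc.
  move/is_derive_eq; apply; rewrite scale0r add0r.
  rewrite -(@sum_delta _ _ i (fun k => r * du k (r *: x))).
  by apply: eq_bigr => k _; rewrite eq_sym; ring.
have c1 := (h _ Gx i).2.
have c2 : du i (r *: y) @[y --> x] --> du i (r *: x).
  exact: (cvg_comp _ _ (@scale_continuous r x) c1).
apply: cvgM c2; exact: cvg_cst.
Qed.

Lemma open_scale G (r : R) : open G -> open [set x : 'rV[R]_d | G (r *: x)].
Proof. by move=> oG; apply: open_comp => // x _; exact: scale_continuous. Qed.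

Variables (r0 : R) (r1 : \bar R).
Local Notation A := (@annulus R d r0 r1).
Definition logItv : set R := [set v | r0 < expR v /\ ((expR v)%:E < r1)%E].

Lemma sphere_annulus v th : logItv v -> enorm th = 1 -> A (expR v *: th).
Proof.
by move=> [h1 h2] th1; split; rewrite enormZ th1 mulr1 gtr0_norm ?expR_gt0.
Qed.

Lemma logItv_near v : logItv v -> exists a b e, [/\ 0 < e, r0 < a, (b%:E < r1)%E &
  forall t, `|t - v| < e -> a <= expR t <= b].
Proof.
move=> [h1 h2].
pose a := (r0 + expR v) / 2.
have ha : r0 < a by rewrite /a; lra.
have hav : a < expR v by rewrite /a; lra.
have [b hb hbr] : exists2 b, expR v < b & (b%:E < r1)%E.
  case: r1 h2 => [r| |].
  - rewrite lte_fin => h; exists ((expR v + r) / 2); first by lra.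
    by rewrite lte_fin; lra.
  - by move=> _; exists (expR v + 1); [lra|rewrite ltry].
  - by rewrite ltNge leNye.
have c := @continuous_expR R v.
have n1 : \forall t \near v, a <= expR t by apply: (cvgr_ge _ c).
have n2 : \forall t \near v, expR t <= b by apply: (cvgr_le _ c).
have n12 : nbhs v [set t : R | a <= expR t /\ expR t <= b] by exact: filterI n1 n2.
have [e /= e0 he] := (nbhs_ballP _ _).1 n12.
exists a, b, e; split => // t ht.
by apply/andP; apply: he; rewrite /ball /= distrC.
Qed.

Definition phi g P (v : R) : R := sphere_intR (fun th => g (expR v *: th) * P th).

Lemma annulus_sphere_cont g v : (forall x, A x -> {for x, continuous g}) -> logItv v ->
  sphere_cont (fun th => g (expR v *: th)).
Proof.
move=> cg Jv; apply: sphere_cont_of => th th1.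
have c1 := cg _ (sphere_annulus Jv th1).
exact: (cvg_comp _ _ (@scale_continuous (expR v) th) c1).
Qed.

(** In the logarithmic radius, d/dv acts as the Euler operator; domination comes from compactness of
    a closed annulus around radius [expR v]. *)
Lemma phi_derive g dg P v : has_grad A g dg -> sphere_cont P -> logItv v ->
  is_derive v (1 : R) (phi g P) (phi (euler dg) P v).
Proof.
move=> hg cP Jv.
have oA : open A by exact: annulus_open.
have ceu x : A x -> {for x, continuous (euler dg)}.
  move=> Ax; apply: (@cvg_sumr _ _ (nbhs x) _ _ _ (fun i x => x 0 i * dg i x) (fun i => x 0 i * dg i x)) => i.
  by apply: cvgM; [exact: coord_continuous|exact: (hg x Ax i).2].
have [a [b [e [e0 ra br he]]]] := logItv_near Jv.
have Je t : `|t - v| < e -> logItv t.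
  move=> /he /andP[h1 h2]; split; first exact: lt_le_trans ra h1.
  by apply: le_lt_trans br; rewrite lee_fin.
have [M hM] : exists M, forall x : 'rV[R]_d, [set x | a <= enorm x <= b] x -> `|euler dg x| <= M.
  apply: compact_bound; first exact: annulus_compact.
  move=> x /= /andP[h1 h2]; apply: ceu; split; first exact: lt_le_trans ra h1.
  by apply: le_lt_trans br; rewrite lee_fin.
have [_ [N hN]] := cP.
apply: (@sphere_derive _ _ d0 (fun t th => g (expR t *: th) * P th)
   (fun t th => euler dg (expR t *: th) * P th) v e (M * N)) => //.
- move=> t /Je Jt; apply: sphere_cont_mul => //.
  by apply: annulus_sphere_cont => // x; exact: has_grad_continuous oA hg.
- by apply: sphere_cont_mul => //; exact: annulus_sphere_cont.
- move=> t th ht th1; split.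
    have dc i : is_derive t (1 : R) (fun s => (expR s *: th) 0 i) (expR t * th 0 i).
      rewrite (_ : (fun s => _) = (fun s => expR s * th 0 i)); last first.
        by apply/funext => s; rewrite mxE.
      by apply: (is_derive_eq (der_mul (is_derive_expR t) (der_cst _ _ _))); rewrite mulr0 addr0.
    have h := chain_rule (c := fun s => expR s *: th) oA hg (sphere_annulus (Je t ht) th1) dc.
    apply: (is_derive_eq (der_mul h (der_cst _ _ _))); rewrite mulr0 addr0; congr (_ * _).
    by apply: eq_bigr => i _; rewrite mxE mulrC.
  rewrite normrM; apply: ler_pM => //; last exact: hN.
  by apply: hM; rewrite /= enormZ th1 mulr1 gtr0_norm ?expR_gt0 //; exact: he.
Qed.

Fixpoint S1 n (J : set R) (F : R -> R) : Prop :=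
  if n is n'.+1 then exists2 F', (forall v : R, J v -> is_derive v (1 : R) F (F' v)) & S1 n' J F'
  else True.

Lemma Cn_euler n G dg : open G -> (forall i, Cn n G (dg i)) -> Cn n G (euler dg).
Proof. by move=> oG h; apply: Cn_sum => i; apply: Cn_mul => //; exact: Cn_coord. Qed.

Lemma phi_S1 n g P : Cn n A g -> sphere_cont P -> S1 n logItv (phi g P).
Proof.
elim: n g => //= n IH g [dg hg cdg] cP; exists (phi (euler dg) P).
  by move=> v; exact: phi_derive.
by apply: IH => //; apply: Cn_euler => //; exact: annulus_open.
Qed.

(** Applying the Euler operator twice gives [quad] plus one more Euler term, which turns the
    coefficient [d - 1] of [sphere_laplacian] into [d - 2]. *)
Lemma phi_ode (k : nat) g P : Cn 2 A g -> harmonic_hom k P ->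
  exists F1 F2, [/\ forall v, logItv v -> is_derive v (1 : R) (phi g P) (F1 v),
    forall v, logItv v -> is_derive v (1 : R) F1 (F2 v) &
    forall v, logItv v -> F2 v + (d%:R - 2) * F1 v - k%:R * (k%:R + d%:R - 2) * phi g P v
      = expR v ^+ 2 * phi (lapR g) P v].
Proof.
move=> cg hP; have oA : open A by exact: annulus_open.
have [dg [ddg [hg hdg cdd lapE]]] := Cn_laplacian oA cg.
have [PC PL _] := hP.
have [dP [ddP [gP gdP _ PlapE]]] := Cn_laplacian openT (PC 2%N).
have cP : sphere_cont P by apply: sphere_cont_of => th _; exact: (has_grad_continuous openT gP I).
exists (phi (euler dg) P), (phi (euler (deuler dg ddg)) P); split.
- by move=> v; exact: phi_derive.
- by move=> v; apply: phi_derive => //; exact: has_grad_euler.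
move=> v Jv; set r := expR v.
pose G := [set x | A (r *: x)].
have oG : open G by exact: open_scale.
have SG th : enorm th = 1 -> G th by exact: sphere_annulus.
have hgr := hg_scale (r := r) oA hg.
have hdgr i := hg_mul oG (@hg_cst R d G r) (hg_scale (r := r) oA (hdg i)).
have hdgr' i : has_grad G (fun x => r * dg i (r *: x)) (fun j x => r ^+ 2 * ddg i j (r *: x)).
  apply: hg_ext (hdgr i) => // x j _; first by ring.
have cdg i : sphere_cont (fun th => dg i (r *: th)).
  by apply: annulus_sphere_cont => // x; exact: has_grad_continuous oA (hdg i).
have cddg i j : sphere_cont (fun th => ddg i j (r *: th)).
  by apply: annulus_sphere_cont => // x; exact: cdd.
have cg0 : sphere_cont (fun th => g (r *: th)).
  by apply: annulus_sphere_cont => // x; exact: has_grad_continuous oA hg.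
have L := sphere_laplacian d0 (k := k%:R) oG SG hgr hdgr' (has_grad_sub (@subsetT _ _) gP)
  (fun i => has_grad_sub (@subsetT _ _) (gdP i)) _ (fun th _ => euler_hom th hP gP)
  (fun th _ => quad_hom th hP gP gdP) _.
have qE th : quad ddg (r *: th) = quad (fun i j x => r ^+ 2 * ddg i j (r *: x)) th.
  by apply: eq_bigr => j _; apply: eq_bigr => i _; rewrite !mxE; ring.
have eE th : euler dg (r *: th) = euler (fun i x => r * dg i (r *: x)) th.
  by apply: eq_bigr => j _; rewrite !mxE; ring.
have ceu : sphere_cont (fun th => euler dg (r *: th)).
  apply: (@sphere_cont_eq _ _ (euler (fun i x => r * dg i (r *: x)))) => [th _|]; first by rewrite eE.
  exact: (euler_sphere_cont oG SG hgr).
have cq : sphere_cont (fun th => quad ddg (r *: th)).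
  apply: (@sphere_cont_eq _ _ (quad (fun i j x => r ^+ 2 * ddg i j (r *: x)))) => [th _|]; first by rewrite qE.
  apply: sphere_cont_quad => i j; apply: sphere_cont_mul => //; exact: sphere_cont_cst.
have clap : sphere_cont (fun th => \sum_i ddg i i (r *: th)) by apply: sphere_cont_sum.
have -> : expR v ^+ 2 * phi (lapR g) P v =
   sphere_intR (fun th => (\sum_j r ^+ 2 * ddg j j (r *: th)) * P th).
  rewrite /phi -/r.
  rewrite (@sphere_eq _ _ d0 _ (fun th => (\sum_i ddg i i (r *: th)) * P th)); last first.
  - by move=> th th1; rewrite lapE //; exact: sphere_annulus.
  - apply: (@sphere_cont_eq _ _ (fun th => (\sum_i ddg i i (r *: th)) * P th)).
      by move=> th th1; rewrite lapE //; exact: sphere_annulus.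
    exact: sphere_cont_mul.
  set F := (fun th => (\sum_i ddg i i (r *: th)) * P th).
  have cF : sphere_cont F by exact: sphere_cont_mul.
  have := sphere_lin d0 (r ^+ 2) 0 cF cF; rewrite mul0r addr0 => <-.
  apply: sphere_eq => //; first exact: sphere_cont_lin.
  by move=> th _; rewrite -mulr_sumr /F; ring.
rewrite L; last 2 first.
- by move=> th _; rewrite -PlapE.
- by move=> i j; apply: sphere_cont_mul => //; exact: sphere_cont_cst.
have c1 : sphere_cont (fun th => euler dg (r *: th) * P th) by exact: sphere_cont_mul.
have c2 : sphere_cont (fun th => quad ddg (r *: th) * P th) by exact: sphere_cont_mul.
have c3 : sphere_cont (fun th => g (r *: th) * P th) by exact: sphere_cont_mul.
have c4 : sphere_cont (fun th => 1 * (euler dg (r *: th) * P th) + 1 * (quad ddg (r *: th) * P th)).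
  exact: sphere_cont_lin.
have -> : phi (euler (deuler dg ddg)) P v =
   1 * phi (euler dg) P v + 1 * sphere_intR (fun th => quad ddg (r *: th) * P th).
  rewrite /phi -/r -sphere_lin //; apply: sphere_eq => //.
    apply: sphere_cont_eq c4 => th th1; rewrite euler_deuler; ring.
  by move=> th _; rewrite euler_deuler; ring.
have c5 : sphere_cont (fun th => 1 * (quad ddg (r *: th) * P th) +
   (d%:R - 1) * (euler dg (r *: th) * P th)) by exact: sphere_cont_lin.
rewrite /phi -/r.
transitivity (1 * (1 * sphere_intR (fun th => quad ddg (r *: th) * P th) +
   (d%:R - 1) * sphere_intR (fun th => euler dg (r *: th) * P th)) +
   (- (k%:R * (k%:R + d%:R - 2))) * sphere_intR (fun th => g (r *: th) * P th)); first by ring.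
rewrite -sphere_lin // -sphere_lin //; apply: sphere_eq => //.
  exact: sphere_cont_lin.
by move=> th _; rewrite qE eE; ring.
Qed.

End Coefficients.

(** * First-order operators on an interval *)

Section FirstOrder.
Context {R : realType}.

Lemma MVT_closed (F F' : R -> R) (a b : R) : a < b ->
  (forall s : R, a <= s <= b -> is_derive s (1 : R) F (F' s)) ->
  exists2 c, a <= c <= b & F b - F a = F' c * (b - a).
Proof.
move=> ab dF.
have dF' c : c \in `[a, b] -> is_derive c (1 : R) F (F' c) by rewrite in_itv /=; exact: dF.
have [c hc ->] := @MVT R F F' a b ab (fun c cab => dF' c (subset_itv_oo_cc cab))
    (@derivable_within_continuous _ _ _ _ (fun c cab => @ex_derive _ _ _ _ _ _ _ (dF' c cab))).
by exists c => //; have := subset_itv_oo_cc hc; rewrite in_itv.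
Qed.

Section Estimate.
Variables (h u H : R -> R) (a b s0 v0 M0 M2 : R).
Hypothesis sv : s0 < v0.
Hypothesis dh : forall s : R, s0 <= s <= v0 -> is_derive s (1 : R) h (a * h s + u s).
Hypothesis du : forall s : R, s0 <= s <= v0 -> is_derive s (1 : R) u (b * u s + H s).
Hypothesis hM : forall s, s0 <= s <= v0 -> `|h s| <= M0.
Hypothesis HM : forall s, s0 <= s <= v0 -> `|H s| <= M2.
Hypothesis ab : b <= a.
Let K := (v0 - s0) * M2 + (a - b) * M0.
Let e s := expR (b * (v0 - s)).
Let F s := e s * ((s - s0) * u s - h s).

Let F' s := e s * ((s - s0) * H s - (a - b) * h s).

Lemma exp_weight_derive (s : R) : is_derive s (1 : R) e (- b * e s).
Proof.
have h1 : is_derive s (1 : R) (fun s : R => b * (v0 + -1 * id s)) (- b).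
  apply: (is_derive_eq (der_mul (der_cst b _ _) (der_add (der_cst v0 _ _)
    (der_mul (der_cst (-1) _ _) (is_derive_id s (1 : R)))))); ring.
have h2 := @is_derive1_comp R expR (fun s : R => b * (v0 + -1 * id s)) s _ _ (is_derive_expR _) h1.
rewrite (_ : e = expR \o (fun s : R => b * (v0 + -1 * id s))); last first.
  by apply/funext => t; rewrite /e /= mulN1r.
by apply: (is_derive_eq h2); rewrite mulrC /e /= mulN1r.
Qed.

(** The weight [e] is the integrating factor for u' = b u + H, the factor [s - s0] removes the
    unknown value [u s0], and [- h] cancels the [u] that arises when this factor is
    differentiated. *)
Lemma weighted_derive (s : R) : s0 <= s <= v0 -> is_derive s (1 : R) F (F' s).
Proof.
move=> hs.
have d1 : is_derive s (1 : R) (fun s : R => id s + - s0) 1.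
  by apply: (is_derive_eq (der_add (is_derive_id s (1 : R)) (der_cst (- s0) s (1 : R)))); rewrite addr0.
have d2 := der_mul (exp_weight_derive s)
   (der_add (der_mul d1 (du hs)) (der_mul (der_cst (-1) s (1 : R)) (dh hs))).
rewrite (_ : F = fun s => e s * ((id s + - s0) * u s + -1 * h s)); last first.
  by apply/funext => t; rewrite /F mulN1r.
by apply: (is_derive_eq d2); rewrite /F' /=; ring.
Qed.

Lemma weight_bound s : s0 <= s <= v0 -> `|(s - s0) * H s - (a - b) * h s| <= K.
Proof.
move=> hs; have /andP[h1 h2] := hs.
apply: le_trans (ler_normB _ _) _; rewrite !normrM.
apply: lerD; apply: ler_pM => //; try exact: hM; try exact: HM.
  by rewrite ger0_norm; lra.
by rewrite ger0_norm ?lexx // subr_ge0.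
Qed.

Lemma weighted_ends : (v0 - s0) * u v0 = (F v0 - F s0) + h v0 - e s0 * h s0.
Proof. by rewrite /F /e !subrr mulr0 expR0 mul0r; ring. Qed.

Lemma end_bound (T E : R) : `|F v0 - F s0| <= T -> e s0 <= E ->
  (v0 - s0) * `|u v0| <= M0 * (1 + E) + T.
Proof.
move=> FT eE.
have p : 0 < v0 - s0 by rewrite subr_gt0.
have hs0 : s0 <= s0 <= v0 by rewrite lexx ltW.
have hv0 : s0 <= v0 <= v0 by rewrite lexx ltW.
rewrite -{1}(gtr0_norm p) -normrM weighted_ends.
apply: le_trans (ler_normB _ _) _; apply: le_trans (lerD (ler_normD _ _) (lexx _)) _.
rewrite normrM [`|e s0|]gtr0_norm ?expR_gt0 //.
have := hM hv0; have := hM hs0; have e0 : 0 < e s0 by exact: expR_gt0.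
move=> h1 h2; have : e s0 * `|h s0| <= E * M0 by apply: ler_pM => //; exact: ltW.
lra.
Qed.

Lemma estimate_const_ge0 : 0 <= K.
Proof.
have hv0 : s0 <= v0 <= v0 by rewrite lexx ltW.
by apply: le_trans (weight_bound hv0).
Qed.

(** Works for either sign of [b], but [K] contains [a - b], of size 2k, so it is useful while [k] is
    comparable to [p]. *)
Lemma estimate_bounded (E : R) : (forall s, s0 <= s <= v0 -> e s <= E) ->
  (v0 - s0) * `|u v0| <= M0 * (1 + E) + (v0 - s0) * (E * K).
Proof.
move=> eE; apply: end_bound; last by apply: eE; rewrite lexx ltW.
have [c hc ->] := MVT_closed sv weighted_derive.
rewrite normrM mulrC gtr0_norm ?subr_gt0 //; apply: ler_wpM2l; first by rewrite subr_ge0 ltW.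
rewrite /F' normrM gtr0_norm ?expR_gt0 //; apply: ler_pM => //; first exact: expR_ge0.
  exact: eE.
exact: weight_bound.
Qed.

(** For [b < 0] the weight has total mass at most [1 / - b] on the interval, which replaces the
    length of the interval and offsets the growth of [a - b] in [k]. *)
Lemma estimate_decay : b < 0 -> (v0 - s0) * `|u v0| <= M0 * 2 + K / - b.
Proof.
move=> b0; rewrite -[2]/(1 + 1); apply: end_bound; last first.
  by rewrite /e -expR0 ler_expR; apply: mulr_le0_ge0; [exact: ltW|rewrite subr_ge0 ltW].
have K0 := estimate_const_ge0.
have nb : 0 < - b by rewrite oppr_gt0.
have side (sg : R) : `|sg| = 1 -> sg * (F v0 - F s0) <= K / - b.
  move=> sg1.
  (* Since [e' = - b e], the first term has derivative [K * e], which dominates that of [sg * F]; so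
     [G] is nondecreasing, which integrates the weight exactly. *)
  pose G s := (K / - b) * e s + (- sg) * F s.
  have dG s : s0 <= s <= v0 -> is_derive s (1 : R) G (K * e s - sg * F' s).
    move=> hs; apply: (is_derive_eq (der_add (der_mul (der_cst _ _ _) (exp_weight_derive s))
      (der_mul (der_cst _ _ _) (weighted_derive hs)))).
    by field; rewrite lt_eqF.
  have [c hc E] := MVT_closed sv dG.
  have : 0 <= G v0 - G s0.
    rewrite E mulr_ge0 //; last by rewrite subr_ge0 ltW.
    have -> : K * e c - sg * F' c = e c * (K - sg * ((c - s0) * H c - (a - b) * h c)).
      by rewrite /F'; ring.
    apply: mulr_ge0; first exact: expR_ge0.
    rewrite subr_ge0; apply: le_trans (ler_norm _) _; rewrite normrM sg1 mul1r.
    exact: weight_bound.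
  have KB : 0 <= K / - b by rewrite divr_ge0 // ltW.
  have e1 : e v0 = 1 by rewrite /e subrr mulr0 expR0.
  have e2 : 0 <= e s0 by exact: expR_ge0.
  rewrite /G e1; have : 0 <= K / - b * e s0 by rewrite mulr_ge0.
  lra.
rewrite ler_norml; apply/andP; split.
  have := side (-1); rewrite normrN normr1 => /(_ erefl); lra.
by have := side 1; rewrite normr1 => /(_ erefl); rewrite mul1r.
Qed.

End Estimate.

Definition DstepR (c : R) (f : R -> R) : R -> R := fun v => derive1 f v - c * f v.

Fixpoint DopR (lm : nat -> R) n (f : R -> R) : R -> R :=
  if n is n'.+1 then DstepR (lm 0%N) (DopR (fun j => lm j.+1) n' f) else f.

Lemma ReF_Dop lm n (g : R -> R[i]) : ReF (Dop lm n g) = DopR lm n (ReF g).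
Proof.
elim: n lm g => //= n IH lm g; rewrite -IH; apply/funext => v.
rewrite /ReF /Dstep /DstepR /derivC /=; case: (Dop _ n g v) => x y /=.
by rewrite mul0r subr0.
Qed.

Lemma ImF_Dop lm n (g : R -> R[i]) : ImF (Dop lm n g) = DopR lm n (ImF g).
Proof.
elim: n lm g => //= n IH lm g; rewrite -IH; apply/funext => v.
rewrite /ImF /Dstep /DstepR /derivC /=; case: (Dop _ n g v) => x y /=.
by rewrite mul0r addr0.
Qed.

(** The recursion adds the outermost factor and shifts the exponents; going from order n to n + 1
    with fixed exponents adds the innermost factor, which must then be commuted to the front. *)
Lemma DopR_last lm n f : DopR lm n.+1 f = DopR lm n (DstepR (lm n) f).
Proof. by elim: n lm => //= n IH lm; rewrite -IH. Qed.

Variable J : set R.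
Hypothesis oJ : open J.

Lemma near_open v : J v -> \forall t \near v, J t.
Proof. by move=> Jv; exact: open_nbhs_nbhs. Qed.

Lemma S1_ext n f g : (forall v, J v -> f v = g v) -> S1 n J f -> S1 n J g.
Proof.
case: n => //= n fg [f' df sf']; exists f' => // v Jv.
apply: is_derive_near (df v Jv); have := near_open Jv.
by apply: filterS => t; exact: fg.
Qed.

Lemma S1S n f : S1 n.+1 J f -> S1 n J f.
Proof. by elim: n f => //= n IH f [f' df sf']; exists f' => //; exact: IH. Qed.

Lemma S1_le m n f : (m <= n)%N -> S1 n J f -> S1 m J f.
Proof. by move/subnK <-; elim: (n - m)%N => // j IH; rewrite addSn => /S1S. Qed.

Lemma S1_add n f g : S1 n J f -> S1 n J g -> S1 n J (fun v => f v + g v).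
Proof.
elim: n f g => //= n IH f g [f' df sf'] [g' dg sg'].
exists (fun v => f' v + g' v); last exact: IH.
by move=> v Jv; apply: der_add; [exact: df|exact: dg].
Qed.

Lemma S1_scale n c f : S1 n J f -> S1 n J (fun v => c * f v).
Proof.
elim: n f => //= n IH f [f' df sf']; exists (fun v => c * f' v); last exact: IH.
move=> v Jv; apply: (is_derive_eq (der_mul (der_cst c _ _) (df v Jv))).
by rewrite mul0r add0r.
Qed.

Lemma DstepR_ext c f g : (forall v, J v -> f v = g v) ->
  forall v, J v -> DstepR c f v = DstepR c g v.
Proof.
move=> fg v Jv; rewrite /DstepR fg // !derive1E; congr (_ - _).
by apply: near_eq_derive; have := near_open Jv; apply: filterS => t; exact: fg.
Qed.

Lemma DopR_ext lm n f g : (forall v, J v -> f v = g v) ->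
  forall v, J v -> DopR lm n f v = DopR lm n g v.
Proof. by move=> fg; elim: n lm => //= n IH lm; apply: DstepR_ext; exact: IH. Qed.

Lemma DstepR_derive c f f' v : J v -> is_derive v (1 : R) f (f' v) ->
  DstepR c f v = f' v - c * f v.
Proof. by move=> Jv [_ e]; rewrite /DstepR derive1E e. Qed.

Lemma S1_DstepR n c f : S1 n.+1 J f -> S1 n J (DstepR c f).
Proof.
move=> sf; have sf0 := S1S sf; case: sf => f' df sf'.
apply: (@S1_ext _ (fun v => f' v + - c * f v)).
  by move=> v Jv; rewrite (DstepR_derive c Jv (df v Jv)) mulNr.
by apply: S1_add => //; exact: S1_scale.
Qed.

Lemma S1_DopR lm n m f : S1 (m + n) J f -> S1 m J (DopR lm n f).
Proof.
elim: n lm m => [|n IH] lm m; first by rewrite addn0.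
by rewrite addnS => h; apply: S1_DstepR; apply: IH; rewrite addSn.
Qed.

Lemma DstepR_comm a c f : S1 2 J f -> forall v, J v ->
  DstepR a (DstepR c f) v = DstepR c (DstepR a f) v.
Proof.
move=> [f1 df [f2 df1 _]] v Jv.
have main b1 b2 : DstepR b1 (DstepR b2 f) v = (f2 v - b2 * f1 v) - b1 * (f1 v - b2 * f v).
  rewrite (@DstepR_ext b1 _ (fun v => f1 v + - b2 * f v)) //; last first.
    by move=> t Jt; rewrite (DstepR_derive b2 Jt (df t Jt)) mulNr.
  have D : is_derive v (1 : R) (fun v => f1 v + - b2 * f v) (f2 v - b2 * f1 v).
    apply: (is_derive_eq (der_add (df1 v Jv) (der_mul (der_cst (- b2) _ _) (df v Jv)))).
    by ring.
  by rewrite (@DstepR_derive b1 _ (fun v => f2 v - b2 * f1 v) _ Jv D) mulNr.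
by rewrite !main; ring.
Qed.

Lemma DopR_DstepR lm n c f : S1 n.+2 J f -> forall v, J v ->
  DopR lm n (DstepR c f) v = DstepR c (DopR lm n f) v.
Proof.
elim: n lm => // n IH lm sf v Jv /=.
rewrite (@DstepR_ext (lm 0%N) _ (DstepR c (DopR (fun j => lm j.+1) n f))) //; last first.
  by apply: IH; exact: S1S.
apply: DstepR_comm => //; apply: S1_DopR; apply: S1_le sf.
by rewrite addSn add1n ltnS leqnSn.
Qed.

End FirstOrder.

(** * Absorbing the factorials in odd orders *)

Section Numeric.
Context {R : realType}.

(** Here [n] stands for p and [X] for the target at order 2p + 1; [M0] and [M2] are the bounds at
    the two even neighbours. With [del] of order 1/(n + 1), both [M0 / del] and [del * M2] are
    bounded multiples of [X], and [k <= 4 n + 4] keeps [(2 k + d - 2) * M0] below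
    [(8 + d) * X / rho]. *)
Lemma odd_bounded (n k d rho del0 X E ub : R) : 0 <= n -> 0 <= k -> 2 <= d ->
  0 < rho -> 0 < del0 -> 0 <= X -> 1 <= E -> k <= 4 * n + 4 ->
  let M0 := X / ((2 * n + 1) * rho) in let M2 := X * ((2 * n + 2) * rho) in
  let del := del0 / (n + 1) in
  del * ub <= M0 * (1 + E) + del * (E * (del * M2 + (2 * k + d - 2) * M0)) ->
  ub <= X * ((6 + E) / (rho * del0) + (2 * del0 * E + 1) * rho + (8 + d) * E / rho).
Proof.
move=> n0 k0 d2 rho0 del00 X0 E1 kn M0 M2 del hub.
have E0 : 0 <= E by lra.
have n1 : 0 < n + 1 by lra.
have n21 : 0 < 2 * n + 1 by lra.
have del_gt0 : 0 < del by rewrite divr_gt0.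
have M0E : M0 = X / rho / (2 * n + 1).
  by rewrite /M0; field; rewrite !gt_eqF.
have Xr : 0 <= X / rho by rewrite divr_ge0 // ltW.
have t1 : M0 <= del * (X / (rho * del0)).
  have -> : del * (X / (rho * del0)) = X / rho / (n + 1).
    by rewrite /del; field; rewrite !gt_eqF.
  rewrite M0E; apply: ler_wpM2l => //; rewrite lef_pV2 ?posrE //; lra.
have t2 : del * M2 = 2 * del0 * rho * X.
  by rewrite /del /M2; field; rewrite gt_eqF.
have t3 : (2 * k + d - 2) * M0 <= (8 + d) * (X / rho).
  rewrite M0E mulrA ler_pdivrMr // mulrAC; apply: ler_wpM2r => //.
  nra.
have P : 0 <= X / (rho * del0) by rewrite divr_ge0 // mulr_ge0 // ltW.
have : del * ub <= del * (X / (rho * del0) * (1 + E) + E * (2 * del0 * rho * X + (8 + d) * (X / rho))).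
  apply: le_trans hub _; rewrite [leRHS]mulrDr; apply: lerD.
    by rewrite [leRHS]mulrA; apply: ler_wpM2r => //; lra.
  apply: ler_wpM2l; first exact: ltW.
  by apply: ler_wpM2l => //; rewrite t2; lra.
rewrite ler_pM2l // => h; apply: le_trans h _.
have -> : X * ((6 + E) / (rho * del0) + (2 * del0 * E + 1) * rho + (8 + d) * E / rho) =
  (X / (rho * del0) * (1 + E) + E * (2 * del0 * rho * X + (8 + d) * (X / rho))) +
  (5 * (X / (rho * del0)) + X * rho).
  by field; rewrite !gt_eqF.
by rewrite lerDl addr_ge0 // mulr_ge0 // ltW.
Qed.

(** The decay rate [k + d - 2 - 2 n] is at least [2 n + 2] and at least a quarter of [2 k + d - 2],
    so the quotient is at most [del * X * rho + 4 M0]. The conclusion repeats the constant of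
    [odd_bounded], so that one constant serves all [k]. *)
Lemma odd_decay (n k d rho del0 X E ub : R) : 0 <= n -> 2 <= d ->
  0 < rho -> 0 < del0 -> 0 <= X -> 1 <= E -> 4 * n + 4 <= k ->
  let M0 := X / ((2 * n + 1) * rho) in let M2 := X * ((2 * n + 2) * rho) in
  let del := del0 / (n + 1) in
  del * ub <= M0 * 2 + (del * M2 + (2 * k + d - 2) * M0) / (k + d - 2 - 2 * n) ->
  ub <= X * ((6 + E) / (rho * del0) + (2 * del0 * E + 1) * rho + (8 + d) * E / rho).
Proof.
move=> n0 d2 rho0 del00 X0 E1 kn M0 M2 del hub.
have E0 : 0 <= E by lra.
have n1 : 0 < n + 1 by lra.
have n21 : 0 < 2 * n + 1 by lra.
have be : 0 < k + d - 2 - 2 * n by lra.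
have del_gt0 : 0 < del by rewrite divr_gt0.
have M0E : M0 = X / rho / (2 * n + 1).
  by rewrite /M0; field; rewrite !gt_eqF.
have Xr : 0 <= X / rho by rewrite divr_ge0 // ltW.
have M00 : 0 <= M0 by rewrite M0E divr_ge0 // ltW.
have P : 0 <= X / (rho * del0) by rewrite divr_ge0 // mulr_ge0 // ltW.
have t1 : M0 <= del * (X / (rho * del0)).
  have -> : del * (X / (rho * del0)) = X / rho / (n + 1).
    by rewrite /del; field; rewrite !gt_eqF.
  rewrite M0E; apply: ler_wpM2l => //; rewrite lef_pV2 ?posrE //; lra.
clearbody del.
have t2 : (del * M2 + (2 * k + d - 2) * M0) / (k + d - 2 - 2 * n) <= del * (X * rho) + 4 * M0.
  rewrite ler_pdivrMr // [leRHS]mulrDl; apply: lerD.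
    rewrite /M2 -!mulrA; apply: ler_wpM2l; first exact: ltW.
    apply: ler_wpM2l => //; rewrite [leRHS]mulrC; apply: ler_wpM2r; [exact: ltW|lra].
  by rewrite [leRHS]mulrAC; apply: ler_wpM2r => //; lra.
have : del * ub <= del * (6 * (X / (rho * del0)) + X * rho).
  apply: le_trans hub _; lra.
rewrite ler_pM2l // => h; apply: le_trans h _.
have -> : X * ((6 + E) / (rho * del0) + (2 * del0 * E + 1) * rho + (8 + d) * E / rho) =
  (6 * (X / (rho * del0)) + X * rho) +
  (E * (X / (rho * del0)) + E * (2 * del0 * rho * X + (8 + d) * (X / rho))).
  by field; rewrite !gt_eqF.
have h1 : 0 <= 2 * del0 * rho * X by rewrite !mulr_ge0 // ltW.
have h2 : 0 <= (8 + d) * (X / rho) by rewrite mulr_ge0 //; lra.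
by rewrite lerDl addr_ge0 // mulr_ge0 // addr_ge0.
Qed.

Local Open Scope complex_scope.

Lemma complex_norm_parts (z : R[i]) (X : R) : `|z| <= X%:C ->
  `|complex.Re z| <= X /\ `|complex.Im z| <= X.
Proof.
case: z => a b; rewrite normc_def lecR /= => h; split; apply: le_trans h.
  by rewrite -sqrtr_sqr ler_wsqrtr // lerDl sqr_ge0.
by rewrite -sqrtr_sqr ler_wsqrtr // lerDr sqr_ge0.
Qed.

Lemma complex_norm_le (z : R[i]) (X : R) : `|complex.Re z| <= X -> `|complex.Im z| <= X ->
  `|z| <= (2 * X)%:C.
Proof.
case: z => a b /= ha hb; rewrite normc_def lecR /=.
have X0 : 0 <= X by apply: le_trans ha.
have X2 : 0 <= 2 * X by rewrite mulr_ge0.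
rewrite -[leRHS](ger0_norm X2) -sqrtr_sqr ler_wsqrtr //.
rewrite -[a ^+ 2]real_normK ?num_real // -[b ^+ 2]real_normK ?num_real //.
have := normr_ge0 a; have := normr_ge0 b; move: ha hb; rewrite !expr2.
move: `|a| `|b| => u v *; nra.
Qed.

End Numeric.

(** * The operators applied to the real coefficients *)

Section Pairs.
Context {R : realType}.
Variable d : nat.
Hypothesis d2 : (2 <= d)%N.
Let d0 : (0 < d)%N. Proof. exact: leq_trans d2. Qed.
Variables (r0 : R) (r1 : \bar R).
Local Notation A := (@annulus R d r0 r1).
Local Notation J := (@logItv R r0 r1).
Variables (k : nat) (f1 f2 P1 P2 : 'rV[R]_d -> R).
Hypothesis cf1 : forall n, Cn n A f1.
Hypothesis cf2 : forall n, Cn n A f2.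
Hypothesis hP1 : harmonic_hom k P1.
Hypothesis hP2 : harmonic_hom k P2.

Definition pair_coef (p : nat) (v : R) : R :=
  phi (iter p lapR f1) P1 v + phi (iter p lapR f2) P2 v.

(** Multiplication by [expR (2 p v)] shifts the exponents [k] and [- k - d + 2] of the radial
    equation by 2p, to [lam k d (2p)] and [lam k d (2p + 1)]. *)
Definition scaled_coef (p : nat) (v : R) : R := expR (p.*2%:R * v) * pair_coef p v.

Lemma harmonic_sphere_cont (P : 'rV[R]_d -> R) : harmonic_hom k P -> sphere_cont P.
Proof.
by move=> [c _ _]; apply: sphere_cont_of => th _; exact: (Cn_cont openT (c 0%N) I).
Qed.

Lemma logItv_open : open J.
Proof.
rewrite openE => v Jv; have [a [b [e [e0 ra br he]]]] := logItv_near Jv.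
apply/nbhs_ballP; exists e => //= t; rewrite /ball /= distrC => /he /andP[h1 h2].
split; first exact: lt_le_trans ra h1.
by apply: le_lt_trans br; rewrite lee_fin.
Qed.

Lemma scaled_coef_ode p : exists U, [/\
  forall v, J v -> is_derive v (1 : R) (scaled_coef p) (lam k d p.*2 * scaled_coef p v + U v) &
  forall v, J v -> is_derive v (1 : R) U (lam k d p.*2.+1 * U v + scaled_coef p.+1 v)].
Proof.
have oA : open A by exact: annulus_open.
have [F1 [F2 [dF1 dF2 oF]]] := phi_ode d0 (Cn_iter_lapR p 2 oA cf1) hP1.
have [G1 [G2 [dG1 dG2 oG]]] := phi_ode d0 (Cn_iter_lapR p 2 oA cf2) hP2.
set c : R := p.*2%:R.
have dexp (v : R) : is_derive v (1 : R) (fun v => expR (c * v)) (c * expR (c * v)).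
  have h := der_mul (der_cst c v (1 : R)) (is_derive_id v (1 : R)).
  have := @is_derive1_comp R expR (fun v => c * id v) v _ _ (is_derive_expR _) h.
  by move/is_derive_eq; apply; rewrite /=; ring.
(* The exponential contributes [c] to the logarithmic derivative, so subtracting [(k + c)] times
   [scaled_coef p] leaves only [- k] inside. *)
exists (fun v => expR (c * v) * ((F1 v + G1 v) + - k%:R * pair_coef p v)).
have lE : lam k d p.*2 = k%:R + c :> R.
  by rewrite /lam odd_double doubleK /c -mul2n natrM.
have lO : lam k d p.*2.+1 = - k%:R - d%:R + 2 + c :> R.
  by rewrite /lam /= odd_double /= uphalf_double /c -mul2n natrM.
have dpair v : J v -> is_derive v (1 : R) (pair_coef p) (F1 v + G1 v).
  by move=> Jv; apply: der_add; [exact: dF1|exact: dG1].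
split => v Jv.
  apply: (is_derive_eq (der_mul (dexp v) (dpair v Jv))).
  by rewrite lE /scaled_coef -/c; ring.
apply: (is_derive_eq (der_mul (dexp v) (der_add (der_add (dF2 v Jv) (dG2 v Jv))
   (der_mul (der_cst (- k%:R) _ _) (dpair v Jv))))).
have -> : scaled_coef p.+1 v = expR (c * v) * (expR v ^+ 2 * phi (lapR (iter p lapR f1)) P1 v +
    expR v ^+ 2 * phi (lapR (iter p lapR f2)) P2 v).
  have e2 : expR (p.+1.*2%:R * v) = expR (c * v) * expR v ^+ 2.
    by rewrite -expRM_natl -expRD doubleS; congr expR; rewrite -addn2 natrD; ring.
  by rewrite /scaled_coef /pair_coef e2 /=; ring.
rewrite -oF // -oG // lO /pair_coef; ring.
Qed.

Lemma scaled_coef_S1 n : S1 n J (scaled_coef 0).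
Proof.
apply: (@S1_ext _ _ logItv_open _ (fun v => phi f1 P1 v + phi f2 P2 v)).
  by move=> v _; rewrite /scaled_coef /pair_coef /= mul0r expR0 mul1r.
by apply: S1_add; apply: phi_S1 => //; exact: harmonic_sphere_cont.
Qed.

(** Once commuted to the front, the factors 2p and 2p + 1 act on [scaled_coef p]: the first yields
    [U], the second sends [U] to [scaled_coef p.+1]. *)
Lemma DopR_coef p v : J v -> DopR (lam k d) p.*2 (scaled_coef 0) v = scaled_coef p v.
Proof.
have oJ := logItv_open.
elim: p v => // p IH v Jv.
have [U [dU1 dU2]] := scaled_coef_ode p.
rewrite doubleS !DopR_last.
rewrite (DopR_DstepR oJ) //; last by apply: S1_DstepR => //; exact: scaled_coef_S1.
transitivity (DstepR (lam k d p.*2) (DstepR (lam k d p.*2.+1) (scaled_coef p)) v).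
  apply: (DstepR_ext oJ) => // t Jt.
  rewrite (DopR_DstepR oJ) //; last exact: scaled_coef_S1.
  exact: (DstepR_ext oJ).
have s2 : S1 2 J (scaled_coef p).
  apply: (@S1_ext _ _ oJ _ (DopR (lam k d) p.*2 (scaled_coef 0))) => //.
  by apply: S1_DopR => //; exact: scaled_coef_S1.
rewrite (DstepR_comm oJ) //.
transitivity (DstepR (lam k d p.*2.+1) U v).
  apply: (DstepR_ext oJ) => // t Jt.
  rewrite (@DstepR_derive _ J _ _ (fun t => lam k d p.*2 * scaled_coef p t + U t) _ Jt (dU1 t Jt)); ring.
rewrite (@DstepR_derive _ J _ _ (fun t => lam k d p.*2.+1 * U t + scaled_coef p.+1 t) _ Jv (dU2 v Jv)); ring.
Qed.

Lemma DopR_coef_odd p v U : J v ->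
  (forall v, J v -> is_derive v (1 : R) (scaled_coef p) (lam k d p.*2 * scaled_coef p v + U v)) ->
  DopR (lam k d) p.*2.+1 (scaled_coef 0) v = U v.
Proof.
have oJ := logItv_open; move=> Jv dU.
rewrite DopR_last (DopR_DstepR oJ) //; last exact: scaled_coef_S1.
transitivity (DstepR (lam k d p.*2) (scaled_coef p) v).
  by apply: (DstepR_ext oJ) => // t Jt; exact: DopR_coef.
rewrite (@DstepR_derive _ J _ _ (fun t => lam k d p.*2 * scaled_coef p t + U t) _ Jv (dU v Jv)); ring.
Qed.

Hypothesis norm1 : sphere_intR (fun th => P1 th * P1 th + P2 th * P2 th) = 1.

(* Since [|P1| + |P2| <= 1 + P1^2 + P2^2], only the normalization of the harmonic enters. *)
Lemma pair_coef_bound p v (M : R) : J v ->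
  (forall th, enorm th = 1 -> `|iter p lapR f1 (expR v *: th)| <= M) ->
  (forall th, enorm th = 1 -> `|iter p lapR f2 (expR v *: th)| <= M) ->
  `|pair_coef p v| <= M * (sphere_intR (fun _ : 'rV[R]_d => 1) + 1).
Proof.
move=> Jv b1 b2; have oA : open A by exact: annulus_open.
have cP1 := harmonic_sphere_cont hP1; have cP2 := harmonic_sphere_cont hP2.
have c1 : sphere_cont (fun th => iter p lapR f1 (expR v *: th)).
  by apply: (annulus_sphere_cont (r0 := r0) (r1 := r1)) => // x; exact: Cn_cont (Cn_iter_lapR p 0 oA cf1).
have c2 : sphere_cont (fun th => iter p lapR f2 (expR v *: th)).
  by apply: (annulus_sphere_cont (r0 := r0) (r1 := r1)) => // x; exact: Cn_cont (Cn_iter_lapR p 0 oA cf2).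
pose F th := 1 * (iter p lapR f1 (expR v *: th) * P1 th) + 1 * (iter p lapR f2 (expR v *: th) * P2 th).
have cF : sphere_cont F by apply: sphere_cont_lin; exact: sphere_cont_mul.
have -> : pair_coef p v = sphere_intR F.
  by rewrite /F sphere_lin ?mul1r //; exact: sphere_cont_mul.
have cN : sphere_cont (fun th => P1 th * P1 th + P2 th * P2 th).
  by apply: sphere_cont_add; exact: sphere_cont_mul.
have c1' := @sphere_cont_cst R d 1.
have bound (sg : R) : `|sg| = 1 -> sg * sphere_intR F <= M * (sphere_intR (fun _ : 'rV[R]_d => 1) + 1).
  move=> sg1.
  have -> : sg * sphere_intR F = sphere_intR (fun th => sg * F th + 0 * F th).
    by rewrite sphere_lin // mul0r addr0.
  have -> : M * (sphere_intR (fun _ : 'rV[R]_d => 1) + 1) =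
    sphere_intR (fun th : 'rV[R]_d => M * 1 + M * (P1 th * P1 th + P2 th * P2 th)).
    by rewrite sphere_lin // norm1 mulrDr.
  apply: sphere_le => //; [exact: sphere_cont_lin|exact: sphere_cont_lin|].
  move=> th th1; rewrite mul0r addr0.
  apply: le_trans (ler_norm _) _; rewrite normrM sg1 mul1r /F !mul1r.
  apply: le_trans (ler_normD _ _) _; rewrite !normrM.
  have M0 : 0 <= M by apply: le_trans (b1 _ th1).
  apply: (@le_trans _ _ (M * `|P1 th| + M * `|P2 th|)).
    by apply: lerD; apply: ler_wpM2r => //; [exact: b1|exact: b2].
  rewrite -!mulrDr; apply: ler_wpM2l => //.
  rewrite -!expr2 -[P1 th ^+ 2]real_normK ?num_real // -[P2 th ^+ 2]real_normK ?num_real //.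
  move: `|P1 th| `|P2 th| => u w.
  have := sqr_ge0 (u - 1 / 2); have := sqr_ge0 (w - 1 / 2); rewrite !expr2; lra.
rewrite ler_norml; apply/andP; split.
  by rewrite lerNl; have := bound (-1); rewrite normrN normr1 mulN1r; apply.
by have := bound 1; rewrite normr1 mul1r; apply.
Qed.

(** In the factor [1 + B], the 1 serves even orders and [B] odd ones; nothing in it depends on [k],
    [P1] or [P2]. *)
Lemma coef_estimate (v0 a C0 tau1 : R) : J v0 -> r0 < a -> a < expR v0 -> 0 < a ->
  0 < C0 -> 0 < tau1 ->
  (forall p x, a <= enorm x <= expR v0 -> `|iter p lapR f1 x| <= C0 * (p.*2)`!%:R * tau1 ^+ p.*2) ->
  (forall p x, a <= enorm x <= expR v0 -> `|iter p lapR f2 x| <= C0 * (p.*2)`!%:R * tau1 ^+ p.*2) ->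
  let rho := expR v0 * tau1 in let del0 := v0 - ln a in let E := expR (2 * del0) in
  let C1 := C0 * (sphere_intR (fun _ : 'rV[R]_d => 1) + 1) in
  forall n, `|DopR (lam k d) n (scaled_coef 0) v0| <=
    C1 * (1 + ((6 + E) / (rho * del0) + (2 * del0 * E + 1) * rho + (8 + d%:R) * E / rho)) *
      n`!%:R * rho ^+ n.
Proof.
move=> Jv0 ra av a0 C00 tau0 b1 b2 rho del0 E C1.
have rho0 : 0 < rho by rewrite mulr_gt0 // expR_gt0.
have del00 : 0 < del0 by rewrite subr_gt0 -ltr_expR lnK.
have E1 : 1 <= E by rewrite -expR0 ler_expR; lra.
have S0 : 0 <= sphere_intR (fun _ : 'rV[R]_d => 1 : R).
  have c1' := @sphere_cont_cst R d 1; have c0' := @sphere_cont_cst R d 0.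
  have e0 : sphere_intR (fun _ : 'rV[R]_d => 0 * 1 + 0 * 1 : R) = 0.
    by rewrite sphere_lin // !mul0r addr0.
  rewrite -[leLHS]e0; apply: sphere_le => //; exact: sphere_cont_lin.
have C10 : 0 <= C1 by rewrite mulr_ge0 // ?ltW //; lra.
set B := (6 + E) / (rho * del0) + (2 * del0 * E + 1) * rho + (8 + d%:R) * E / rho.
have dR : 2 <= d%:R :> R by rewrite ler_nat.
have B0 : 0 <= B.
  have E0 : 0 <= E by lra.
  have dE : 0 <= del0 * E by rewrite mulr_ge0 // ltW.
  have q1 : 0 <= (6 + E) / (rho * del0).
    by apply: divr_ge0; [lra|rewrite mulr_ge0 // ltW].
  have q2 : 0 <= (2 * del0 * E + 1) * rho by apply: mulr_ge0; [lra|exact: ltW].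
  have q3 : 0 <= (8 + d%:R) * E / rho.
    by apply: divr_ge0; [apply: mulr_ge0; lra|exact: ltW].
  exact: addr_ge0 (addr_ge0 q1 q2) q3.
have Jv s : ln a <= s <= v0 -> J s.
  move=> /andP[h1 h2]; split.
    by apply: lt_le_trans ra _; rewrite -[leLHS]lnK // ler_expR.
  by case: Jv0 => _; apply: le_lt_trans; rewrite lee_fin ler_expR.
have bound p s : ln a <= s <= v0 -> `|scaled_coef p s| <= C1 * (p.*2)`!%:R * rho ^+ p.*2.
  move=> hs; have /andP[h1 h2] := hs.
  have hx (th : 'rV[R]_d) : enorm th = 1 -> a <= enorm (expR s *: th) <= expR v0.
    move=> th1; rewrite enormZ th1 mulr1 gtr0_norm ?expR_gt0 // ler_expR h2 andbT.
    by rewrite -[leLHS]lnK // ler_expR.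
  have h := pair_coef_bound (Jv s hs) (fun th th1 => b1 p _ (hx th th1)) (fun th th1 => b2 p _ (hx th th1)).
  rewrite /scaled_coef normrM gtr0_norm ?expR_gt0 //.
  (* Here it matters that the interval ends at [v0]: the radius [expR s] never exceeds [expR v0]. *)
  have e1 : expR (p.*2%:R * s) <= expR v0 ^+ p.*2.
    by rewrite -expRM_natl ler_expR; apply: ler_wpM2l.
  apply: (@le_trans _ _ (expR v0 ^+ p.*2 * (C0 * (p.*2)`!%:R * tau1 ^+ p.*2 * (sphere_intR (fun _ : 'rV[R]_d => 1) + 1)))).
    by apply: ler_pM => //; exact: expR_ge0.
  by rewrite /rho exprMn /C1 le_eqVlt; apply/orP; left; apply/eqP; ring.
have hv0 : ln a <= v0 <= v0 by rewrite lexx andbT -subr_ge0 ltW.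
move=> n.
have [p [->|->]] : exists p, n = p.*2 \/ n = p.*2.+1.
  exists n./2; rewrite -{1 3}(odd_double_half n); case: (odd n); [by right|by left].
  rewrite DopR_coef //; apply: le_trans (bound p v0 hv0) _.
  have -> : C1 * (1 + B) * (p.*2)`!%:R * rho ^+ p.*2 =
    C1 * (p.*2)`!%:R * rho ^+ p.*2 + B * (C1 * (p.*2)`!%:R * rho ^+ p.*2) by ring.
  rewrite lerDl; apply: mulr_ge0 => //; apply: mulr_ge0; last exact: exprn_ge0 (ltW rho0).
  exact: mulr_ge0.
have [U [dU1 dU2]] := scaled_coef_ode p.
rewrite (DopR_coef_odd Jv0 dU1).
set X := C1 * (p.*2.+1)`!%:R * rho ^+ p.*2.+1.
have X0 : 0 <= X by apply: mulr_ge0; [exact: mulr_ge0|exact: exprn_ge0 (ltW rho0)].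
suff h : `|U v0| <= X * B.
  apply: le_trans h _.
  have -> : C1 * (1 + B) * (p.*2.+1)`!%:R * rho ^+ p.*2.+1 = X + X * B by rewrite /X; ring.
  by rewrite lerDr.
have p0 : 0 <= p%:R :> R by [].
have p1 : 0 < p%:R + 1 :> R by lra.
(* [del0] is the room between [ln a] and [v0], so the shortened interval stays inside the region of
   the bounds. *)
set del := del0 / (p%:R + 1).
have del_gt0 : 0 < del by rewrite divr_gt0.
have del_le : del <= del0 by rewrite /del ler_pdivrMr // mulrDr mulr1 lerDr mulr_ge0 // ltW.
have vs : v0 - (v0 - del) = del by ring.
have sv : v0 - del < v0 by lra.
have hs s : v0 - del <= s <= v0 -> ln a <= s <= v0.
  by move=> /andP[h1 h2]; rewrite h2 andbT; apply: le_trans h1; rewrite /del0 in del_le; lra.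
set M0 := X / ((2 * p%:R + 1) * rho); set M2 := X * ((2 * p%:R + 2) * rho).
have p2R : p.*2%:R = 2 * p%:R :> R by rewrite -mul2n natrM.
have nS : p.*2.+1%:R = 2 * p%:R + 1 :> R by rewrite -natr1 p2R.
have nSS : p.*2.+2%:R = 2 * p%:R + 2 :> R by rewrite -natr1 nS; ring.
have eM0 : C1 * (p.*2)`!%:R * rho ^+ p.*2 = M0.
  rewrite /M0 /X factS natrM exprS nS; field.
  by rewrite !gt_eqF //; lra.
have eM2 : C1 * (p.+1.*2)`!%:R * rho ^+ p.+1.*2 = M2.
  rewrite /M2 /X doubleS [in LHS]factS [in LHS]natrM [in LHS]exprS nSS; ring.
have hM s : v0 - del <= s <= v0 -> `|scaled_coef p s| <= M0.
  by rewrite -eM0 => /hs /bound.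
have HM s : v0 - del <= s <= v0 -> `|scaled_coef p.+1 s| <= M2.
  by rewrite -eM2 => /hs /bound.
have dh (s : R) : v0 - del <= s <= v0 ->
   is_derive s (1 : R) (scaled_coef p) (lam k d p.*2 * scaled_coef p s + U s).
  by move=> /hs /Jv; exact: dU1.
have du (s : R) : v0 - del <= s <= v0 ->
   is_derive s (1 : R) U (lam k d p.*2.+1 * U s + scaled_coef p.+1 s).
  by move=> /hs /Jv; exact: dU2.
have lE : lam k d p.*2 = k%:R + 2 * p%:R :> R by rewrite /lam odd_double doubleK.
have lO : lam k d p.*2.+1 = - k%:R - d%:R + 2 + 2 * p%:R :> R.
  by rewrite /lam /= odd_double /= uphalf_double.
have k0 : 0 <= k%:R :> R by [].
have ab : lam k d p.*2.+1 <= lam k d p.*2 :> R by rewrite lE lO; lra.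
have abE : lam k d p.*2 - lam k d p.*2.+1 = 2 * k%:R + d%:R - 2 :> R by rewrite lE lO; ring.
have [kp|kp] := leP (k%:R : R) (4 * p%:R + 4).
  apply: (@odd_bounded _ p%:R k%:R) => //.
  have := @estimate_bounded _ _ _ _ _ _ _ _ _ _ sv dh du hM HM ab E.
  rewrite vs abE; apply=> s /andP[h1 h2].
  rewrite /E ler_expR lO.
  have s1 : 0 <= v0 - s by lra.
  have s2 : v0 - s <= del by lra.
  (* The exponent [b] is at most 2p, and 2p times [del] is at most [2 * del0]: this is the origin of
     [E]. *)
  apply: (@le_trans _ _ (2 * p%:R * (v0 - s))); first by apply: ler_wpM2r => //; lra.
  apply: (@le_trans _ _ (2 * p%:R * del)); first by apply: ler_wpM2l => //; rewrite mulr_ge0.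
  by rewrite /del mulrA ler_pdivrMr // ; have := ltW del00; nra.
apply: (@odd_decay _ p%:R k%:R) => //; first exact: ltW.
have b0 : lam k d p.*2.+1 < 0 :> R by rewrite lO; lra.
have := @estimate_decay _ _ _ _ _ _ _ _ _ _ sv dh du hM HM ab b0.
rewrite vs abE lO; congr (_ <= _ + _ / _); ring.
Qed.

End Pairs.

(** * From complex to real coefficients and conclusion *)

Section Main.
Context {R : realType}.
Local Open Scope complex_scope.

Lemma ReF_iter_lapC d (f : 'rV[R]_d -> R[i]) p : ReF (iter p lapC f) = iter p lapR (ReF f).
Proof.
have E (g : 'rV[R]_d -> R[i]) : ReF (lapC g) = lapR (ReF g) by apply/funext.
by elim: p => [|p IH]; [by []|rewrite !iterS E IH].
Qed.

Lemma ImF_iter_lapC d (f : 'rV[R]_d -> R[i]) p : ImF (iter p lapC f) = iter p lapR (ImF f).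
Proof.
have E (g : 'rV[R]_d -> R[i]) : ImF (lapC g) = lapR (ImF g) by apply/funext.
by elim: p => [|p IH]; [by []|rewrite !iterS E IH].
Qed.

Lemma ReF_mul_conj d (f Y : 'rV[R]_d -> R[i]) :
  ReF (fun th => f th * Num.conj (Y th)) = fun th => ReF f th * ReF Y th + ImF f th * ImF Y th.
Proof.
apply/funext => th; rewrite /ReF /ImF; case: (f th) => x y; case: (Y th) => z t /=.
by rewrite mulrN opprK.
Qed.

(** The sign goes to [ImF Y], which stays harmonic, so the imaginary part is a pair of the same form
    as the real part. *)
Lemma ImF_mul_conj d (f Y : 'rV[R]_d -> R[i]) :
  ImF (fun th => f th * Num.conj (Y th)) = fun th => ImF f th * ReF Y th + ReF f th * (-1 * ImF Y th).
Proof.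
apply/funext => th; rewrite /ReF /ImF; case: (f th) => x y; case: (Y th) => z t /=.
by ring.
Qed.

Lemma harmonic_hom_opp d k (P : 'rV[R]_d -> R) : harmonic_hom k P ->
  harmonic_hom k (fun x => -1 * P x).
Proof.
move=> [c L h]; split.
- by move=> n; apply: Cn_mul => //; [exact: openT|exact: Cn_cst].
- move=> x; have [dP [ddP [gP gdP _ lE]]] := Cn_laplacian openT (c 2%N).
  have g1 := hg_mul openT (@hg_cst R d setT (-1)) gP.
  have g1' : has_grad setT (fun x => -1 * P x) (fun i x => -1 * dP i x).
    by apply: hg_ext g1; [exact: openT| |move=> y i _; ring].
  have g2 i : has_grad setT (fun x => -1 * dP i x) (fun j x => -1 * ddP i j x).
    have := hg_mul openT (@hg_cst R d setT (-1)) (gdP i).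
    by apply: hg_ext; [exact: openT| |move=> y j _; ring].
  have -> : lapR (fun x => -1 * P x) x = \sum_i -1 * ddP i i x.
    apply: eq_bigr => i _; have [_ <-] := (g2 i x I i).1.
    have nT : nbhs x [set: 'rV[R]_d] by exact: filterT.
    apply: near_eq_derive; apply: filterS nT => y _.
    by have [[_ <-] _] := g1' y I i.
  by rewrite -mulr_sumr -lE // L mulr0.
- by move=> t x; rewrite h; ring.
Qed.

End Main.

Local Open Scope complex_scope.

Theorem mainTheorem11 (R : realType) (d : nat) (hd : (2 <= d)%N)
  (a : nat -> nat) (Y : nat -> nat -> 'rV[R]_d -> R[i]) (hY : sph_harm_onb a Y)
  (r0 : R) (r1 : \bar R) (hr0 : 0 <= r0) (hr01 : (r0%:E < r1)%E)
  (tau : R) (htau : 0 <= tau)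
  (f : 'rV[R]_d -> R[i]) (hf : polyharmonic_inf (annulus r0 r1) f tau) :
  forall v0 : R, r0 < expR v0 -> ((expR v0)%:E < r1)%E ->
  forall eps : R, 0 < eps ->
  exists C : R, 0 < C /\
    forall (n k l : nat), (1 <= l <= a k)%N ->
      `| Dop (lam k d) n (fun v => fkl f Y k l (expR v)) v0 |
        <= (C * n`!%:R * (expR v0 * (tau + eps)) ^+ n)%:C.
Proof.
move=> v0 hv0 hv1 eps eps0; have [[smR smI] hf2] := hf.
have d0 : (0 < d)%N by exact: leq_trans hd.
(* A radius strictly between [r0] and [expR v0], positive even if [r0 = 0], so that [ln al] is
   meaningful. *)
pose al := (r0 + expR v0) / 2.
have h1 : r0 < al by rewrite /al; lra.
have h2 : al < expR v0 by rewrite /al; lra.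
have h0 : 0 < al by rewrite /al; have := expR_gt0 v0; lra.
have KA : [set x : 'rV[R]_d | al <= enorm x <= expR v0] `<=` annulus r0 r1.
  move=> x /= /andP[x1 x2]; split; first exact: lt_le_trans h1 x1.
  by apply: le_lt_trans hv1; rewrite lee_fin.
have [C0 [C00 hC]] := hf2 _ (@annulus_compact R d al (expR v0)) KA eps eps0.
have te : 0 < tau + eps by lra.
have Jv0 : logItv r0 r1 v0 by [].
pose fR := ReF f; pose fI := ImF f.
have cR n : Cn n (@annulus R d r0 r1) fR by exact: smoothR_Cn.
have cI n : Cn n (@annulus R d r0 r1) fI by exact: smoothR_Cn.
have bR p (x : 'rV[R]_d) : al <= enorm x <= expR v0 ->
    `|iter p lapR fR x| <= C0 * (p.*2)`!%:R * (tau + eps) ^+ p.*2.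
  by move=> hx; rewrite -ReF_iter_lapC; exact: (complex_norm_parts (hC p x hx)).1.
have bI p (x : 'rV[R]_d) : al <= enorm x <= expR v0 ->
    `|iter p lapR fI x| <= C0 * (p.*2)`!%:R * (tau + eps) ^+ p.*2.
  by move=> hx; rewrite -ImF_iter_lapC; exact: (complex_norm_parts (hC p x hx)).2.
pose rho := expR v0 * (tau + eps); pose del0 := v0 - ln al; pose E := expR (2 * del0).
pose B := (6 + E) / (rho * del0) + (2 * del0 * E + 1) * rho + (8 + d%:R) * E / rho.
pose C1 := C0 * (sphere_intR (fun _ : 'rV[R]_d => 1) + 1) * (1 + B).
(* The factor 2 recombines real and imaginary parts; the absolute value and the added 1 give
   positivity. The choice precedes [n], [k] and [l]. *)
exists (`|2 * C1| + 1); split; first by rewrite ltr_wpDl.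
move=> n k l hl.
have [hh [ho _]] := hY k.
have [HR HI] := harm_hom_poly_parts (hh l hl).
pose PR := ReF (Y k l); pose PI := ImF (Y k l).
have norm1 : sphere_intR (fun th => PR th * PR th + PI th * PI th) = 1.
  have := ho l l hl hl; rewrite eqxx /sphere_int ReF_mul_conj => h.
  exact: (congr1 (@complex.Re R) h).
have norm2 : sphere_intR (fun th => PR th * PR th + (-1 * PI th) * (-1 * PI th)) = 1.
  by rewrite -[RHS]norm1; congr sphere_intR; apply/funext => th; ring.
have HI' := harmonic_hom_opp HI.
have estR := coef_estimate hd cR cI HR HI norm1 Jv0 h1 h2 h0 C00 te bR bI n.
have estI := coef_estimate hd cI cR HR HI' norm2 Jv0 h1 h2 h0 C00 te bI bR n.
have sc := @sphere_cont_mul R d.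
have oA : open (@annulus R d r0 r1) by exact: annulus_open.
have oJ := @logItv_open R r0 r1.
have cPR : sphere_cont PR by exact: harmonic_sphere_cont HR.
have cPI : sphere_cont PI by exact: harmonic_sphere_cont HI.
have cPI' : sphere_cont (fun th => -1 * PI th) by exact: harmonic_sphere_cont HI'.
have cfR v : logItv r0 r1 v -> sphere_cont (fun th => fR (expR v *: th)).
  by move=> Jv; apply: (annulus_sphere_cont _ Jv) => x; exact: Cn_cont (cR 0%N).
have cfI v : logItv r0 r1 v -> sphere_cont (fun th => fI (expR v *: th)).
  by move=> Jv; apply: (annulus_sphere_cont _ Jv) => x; exact: Cn_cont (cI 0%N).
pose D := Dop (lam k d) n (fun v => fkl f Y k l (expR v)) v0.
have split_coef (g1 g2 Q1 Q2 : 'rV[R]_d -> R) v : sphere_cont Q1 -> sphere_cont Q2 ->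
    sphere_cont (fun th => g1 (expR v *: th)) -> sphere_cont (fun th => g2 (expR v *: th)) ->
    sphere_intR (fun th => g1 (expR v *: th) * Q1 th + g2 (expR v *: th) * Q2 th)
    = scaled_coef g1 g2 Q1 Q2 0 v.
  move=> q1 q2 e1 e2; rewrite /scaled_coef /pair_coef /phi /= mul0r expR0 mul1r.
  have := sphere_lin d0 1 1 (sc _ _ e1 q1) (sc _ _ e2 q2); rewrite !mul1r => <-.
  by congr sphere_intR; apply/funext => th; rewrite !mul1r.
have DR : complex.Re D = DopR (lam k d) n (scaled_coef fR fI PR PI 0) v0.
  have -> : complex.Re D = DopR (lam k d) n (ReF (fun v => fkl f Y k l (expR v))) v0.
    by rewrite -ReF_Dop.
  apply: (DopR_ext oJ) => // v Jv.
  rewrite -split_coef //; [|exact: cfR|exact: cfI].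
  by rewrite /ReF /fkl /sphere_int /= ReF_mul_conj.
have DI : complex.Im D = DopR (lam k d) n (scaled_coef fI fR PR (fun th => -1 * PI th) 0) v0.
  have -> : complex.Im D = DopR (lam k d) n (ImF (fun v => fkl f Y k l (expR v))) v0.
    by rewrite -ImF_Dop.
  apply: (DopR_ext oJ) => // v Jv.
  rewrite -split_coef //; [|exact: cfI|exact: cfR].
  by rewrite /ImF /fkl /sphere_int /= ImF_mul_conj.
have := @complex_norm_le R D (C1 * n`!%:R * rho ^+ n).
rewrite DR DI => /(_ estR estI) h; apply: le_trans h _.
clearbody C1; rewrite lecR.
have -> : 2 * (C1 * n`!%:R * rho ^+ n) = 2 * C1 * n`!%:R * rho ^+ n by ring.
apply: ler_wpM2r.
  by apply: exprn_ge0; rewrite mulr_ge0 ?expR_ge0 // ltW.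
apply: ler_wpM2r => //.
by apply: le_trans (ler_norm _) _; rewrite lerDl.
Qed.
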